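(* Let $n=2s\ge4$ be even, $R_0$ a field of characteristic zero, and $R=R_0[b_{ij}:1\le i<j\le n]$. Let $\mathbb F$ be the split exact complex $0\to F_3\xrightarrow{d_3}F_2\xrightarrow{d_2}F_1\xrightarrow{d_1}R$ of free modules with bases $\{g\}$ of $F_3$, $\{f_1,\dots,f_n\}$ of $F_2$, $\{e_1,\dots,e_n\}$ of $F_1$ and $d_3(g)=f_n$, $d_2(f_h)=e_h$ for $h\le n-1$, $d_2(f_n)=0$, $d_1(e_i)=0$ for $i\le n-1$, $d_1(e_n)=1$. Then the differentials of the complex $\mathbb F^{top}_\bullet$ associated to $\mathbb F$ (see context) are $$v^{(1)}_{top}=\begin{bmatrix}P_{\hat1,\hat n}&-P_{\hat2,\hat n}&\cdots&P_{\widehat{n-1},\hat n}&0\end{bmatrix},$$ $$v^{(2)}_{top}=\begin{bmatrix}0&-b_{12}&-b_{13}&\cdots&-b_{1,n-1}&0\\ b_{12}&0&-b_{23}&\cdots&-b_{2,n-1}&0\\ b_{13}&b_{23}&0&\cdots&-b_{3,n-1}&0\\ \vdots&\vdots&\vdots&\ddots&\vdots&\vdots\\ b_{1,n-1}&b_{2,n-1}&b_{3,n-1}&\cdots&0&0\\ b_{1n}&b_{2n}&b_{3n}&\cdots&b_{n-1,n}&1\end{bmatrix},\qquad v^{(3)}_{top}=\begin{bmatrix}-P_{\hat1,\hat n}\\P_{\hat2,\hat n}\\ \vdots\\-P_{\widehat{n-1},\hat n}\\P\end{bmatrix}.$$ Here the $i$-th entry of $v^{(1)}_{top}$ is $(-1)^{i+1}P_{\hat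 i,\hat n}$ and the $i$-th entry of $v^{(3)}_{top}$ is $(-1)^iP_{\hat i,\hat n}$ for $i\le n-1$. Moreover, the complex $\mathbb F^{top}_\bullet:\ 0\to R\xrightarrow{v^{(3)}_{top}}R^n\xrightarrow{v^{(2)}_{top}}R^n\xrightarrow{v^{(1)}_{top}}R$ is acyclic.
   Context: Notation. $b_{ji}=-b_{ij}$, $b_{ii}=0$, and $B=(b_{ij})$ is the generic $n\times n$ skew-symmetric matrix. $P$ is the pfaffian of $B$; for $i<j$, $P_{\hat i,\hat j}$ is the pfaffian of the submatrix of $B$ obtained by deleting rows and columns $i,j$. A complex $0\to C_3\to C_2\to C_1\to C_0$ is acyclic if its homology vanishes except at $C_0$. Definition of $\mathbb F^{top}_\bullet$. All modules are over $R$. (a) For $i<j$ put $e_i\cdot e_j=\alpha_{ij}+b_{ij}f_n$, where $\alpha_{ij}$ is the unique element of $\langle f_1,\dots,f_{n-1}\rangle$ with $d_2(\alpha_{ij})=d_1(e_i)e_j-d_1(e_j)e_i$; put $e_j\cdot e_i=-e_i\cdot e_j$, $e_i\cdot e_i=0$. (b) $e_i\cdot f_h\in F_3$ is the unique element with $d_3(e_i\cdot f_h)=d_1(e_i)f_h-e_i\cdot d_2(f_h)$, where $e_i\cdot\sum_ja_je_j=\sum_ja_j\,e_i\cdot e_j$. (c) For $I=\{i_1<\dots<i_{2t}\}\subseteq\{1,\dots,n\}$ define $v^{(3)}_t(I)\in S_{t-1}F_3\otimes F_2$ recursively. Put $v^{(3)}_1(\{i<j\})=e_i\cdot e_j$.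 For $t\ge2$, $v^{(3)}_t(I)$ is the unique lift, along the injection $S_{t-1}F_3\otimes F_2\to S_{t-2}F_3\otimes S_2F_2$, $g^{t-1}\otimes f\mapsto g^{t-2}\otimes f_nf$, of the image in $S_{t-2}F_3\otimes S_2F_2$ of $\sum_{a=1}^{2t-1}(-1)^{a+1}(e_{i_a}\cdot e_{i_{2t}})\otimes v^{(3)}_{t-1}(I\setminus\{i_a,i_{2t}\})$. (d) For each $i$, let $q_i=\sum_{j<i}(-1)^{j+1}d_1(e_j)v^{(3)}_{s-1}(\{1,\dots,n\}\setminus\{i,j\})+\sum_{j>i}(-1)^{j}d_1(e_j)v^{(3)}_{s-1}(\{1,\dots,n\}\setminus\{i,j\})$, an element of $S_{s-2}F_3\otimes F_2$. It lifts uniquely along $S_{s-1}F_3\to S_{s-2}F_3\otimes F_2$, $g^{s-1}\mapsto g^{s-2}\otimes f_n$. Then: the $h$-th entry of $v^{(3)}_{top}$ is the coefficient of $g^{s-1}\otimes f_h$ in $v^{(3)}_s(\{1,\dots,n\})$; the $(i,h)$ entry of $v^{(2)}_{top}$ is the coefficient of $g$ in $e_i\cdot f_h$; the $i$-th entry of $v^{(1)}_{top}$ is $(-1)^{i+1}$ times the coefficient of $g^{s-1}$ in the lift of $q_i$. *)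

(* Defs.v *)
From HB Require Import structures.
From mathcomp Require Import all_boot all_order all_fingroup all_algebra.
From mathcomp Require Import mpoly.

Set Implicit Arguments.
Unset Strict Implicit.
Unset Printing Implicit Defensive.

Import GRing.Theory.
Local Open Scope ring_scope.

Section Pfaffian.
Variables (R : comNzRingType) (k : nat).

Fact fst_of_subproof (a : 'I_(k./2)) : (a.*2 < k)%N.
Proof.
by rewrite -[k in ltnRHS]odd_double_half ltn_addl // ltn_double.
Qed.

Fact snd_of_subproof (a : 'I_(k./2)) : (a.*2.+1 < k)%N.
Proof.
by rewrite -[k in ltnRHS]odd_double_half ltn_addl // -doubleS leq_double.
Qed.

Definition fst_of (a : 'I_(k./2)) : 'I_k := Ordinal (fst_of_subproof a).
Definition snd_of (a : 'I_(k./2)) : 'I_k := Ordinal (snd_of_subproof a).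

(* Each perfect matching of 'I_k is listed by exactly one such permutation s:
   its pairs are {s 0, s 1}, {s 2, s 3}, ..., with s 0 < s 1, s 2 < s 3, ...
   and s 0 < s 2 < ... *)
Definition matching_perm (s : 'S_k) : bool :=
  [forall a : 'I_(k./2), (s (fst_of a) < s (snd_of a))%N] &&
  [forall a : 'I_(k./2), forall c : 'I_(k./2),
     (a < c)%N ==> (s (fst_of a) < s (fst_of c))%N].

Definition pfaffian (A : 'M[R]_k) : R :=
  if odd k then 0 else
  \sum_(s : 'S_k | matching_perm s)
    (-1) ^+ s * \prod_a A (s (fst_of a)) (s (snd_of a)).

End Pfaffian.

(* enum_val enumerates a set of ordinals in increasing order. *)
Definition principal_submx (R : Type) (n : nat) (A : 'M[R]_n)
    (I : {set 'I_n}) : 'M[R]_#|I| :=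
  \matrix_(a, c) A (enum_val a) (enum_val c).

Definition pfaffian_hat (R : comNzRingType) (n : nat) (A : 'M[R]_n)
    (i j : 'I_n) : R :=
  pfaffian (principal_submx A (~: [set i; j])).

Definition ltpair (n : nat) : finType := {p : 'I_n * 'I_n | (p.1 < p.2)%N}.

Notation genR R0 n := {mpoly R0[#|{: ltpair n}|]}.

Definition bvar (R0 : fieldType) (n : nat) (i j : 'I_n) : genR R0 n :=
  if insub (i, j) is Some p then 'X_(enum_rank (p : ltpair n)) else 0.

(* At most one of the two terms is nonzero, as bvar R0 i j = 0 unless i < j. *)
Definition genB (R0 : fieldType) (n : nat) : 'M[genR R0 n]_n :=
  \matrix_(i, j) (bvar R0 i j - bvar R0 j i).

(* Here n = m.+1 and the last index n is ord_max; indices start at 0, which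
   shifts the parity of every sign exponent given by an index starting at 1.
   F_1, F_2 = 'cV_n and F_3 = 'cV_1, and the differentials are matrices acting
   on columns: d1 (e_i) = d1 0 i, d2 (f_h) = col h d2, d3 (g) = d3. *)
Section TopComplex.
Variables (R : comNzRingType) (m : nat).
Local Notation n := m.+1.
Variables (B : 'M[R]_n) (d1 : 'rV[R]_n) (d2 : 'M[R]_n) (d3 : 'cV[R]_n).

Definition bas (i : 'I_n) : 'cV[R]_n := delta_mx i 0.

Definition in_span_butlast (x : 'cV[R]_n) : Prop :=
  exists c : 'I_m -> R, x = \sum_(h < m) c h *: bas (lift ord_max h).

Definition is_prod11 (ee : 'I_n -> 'I_n -> 'cV[R]_n) : Prop :=
  (forall i j : 'I_n, (i < j)%N ->
     exists2 alpha : 'cV[R]_n,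
       unique (fun x => in_span_butlast x /\
                 d2 *m x = d1 0 i *: bas j - d1 0 j *: bas i) alpha
     & ee i j = alpha + B i j *: bas ord_max) /\
  (forall i j : 'I_n, (i < j)%N -> ee j i = - ee i j) /\
  (forall i : 'I_n, ee i i = 0).

Definition act11 (ee : 'I_n -> 'I_n -> 'cV[R]_n) (i : 'I_n) (x : 'cV[R]_n)
    : 'cV[R]_n :=
  \sum_j x j 0 *: ee i j.

Definition is_prod12 (ee : 'I_n -> 'I_n -> 'cV[R]_n)
    (ef : 'I_n -> 'I_n -> 'cV[R]_1) : Prop :=
  forall i h : 'I_n,
    unique (fun x : 'cV[R]_1 =>
              d3 *m x = d1 0 i *: bas h - act11 ee i (col h d2)) (ef i h).

(* Sym(F_3) (x) Sym(F_2) = R[f_1, ..., f_n][g], where f_h is the variable 'X_h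
   of {mpoly R[n]} and g is the variable of the outer {poly _}; the summand
   S_k F_3 (x) S_l F_2 is the part of bidegree (k, l), and the tensor product
   of elements is the product of polynomials. *)
Local Notation symT := {poly {mpoly R[n]}}.

Definition in_sym (k l : nat) (z : symT) : Prop :=
  exists2 c : {mpoly R[n]}, c \is l.-homog & z = c *: 'X^k.

Definition symF2 (x : 'cV[R]_n) : symT :=
  (\sum_h x h 0 *: ('X_h : {mpoly R[n]}))%:P.

(* g^k f |-> g^(k-1) f_n f; drop_poly 1 divides by g. *)
Definition sym_inj (z : symT) : symT :=
  ('X_(ord_max : 'I_n) : {mpoly R[n]}) *: drop_poly 1 z.

Definition is_sym_lift (k l : nat) (q z : symT) : Prop :=
  unique (fun w => in_sym k l w /\ sym_inj w = q) z.

(* The element of I with a elements of I below it (enum I is increasing). *)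
Definition elt (I : {set 'I_n}) (a : nat) : 'I_n := nth ord0 (enum I) a.

Definition v3_rhs (ee : 'I_n -> 'I_n -> 'cV[R]_n)
    (v : nat -> {set 'I_n} -> symT) (t : nat) (I : {set 'I_n}) : symT :=
  let l := elt I t.*2.-1 in
  \sum_(a < t.*2.-1)
    (-1) ^+ a * (symF2 (ee (elt I a) l) * v t.-1 (I :\: [set elt I a; l])).

Definition is_v3 (ee : 'I_n -> 'I_n -> 'cV[R]_n)
    (v : nat -> {set 'I_n} -> symT) : Prop :=
  (forall i j : 'I_n, (i < j)%N -> v 1%N [set i; j] = symF2 (ee i j)) /\
  (forall (t : nat) (I : {set 'I_n}), (2 <= t)%N -> #|I| = t.*2 ->
     is_sym_lift t.-1 1 (v3_rhs ee v t I) (v t I)).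

Definition qelt (s : nat) (v : nat -> {set 'I_n} -> symT) (i : 'I_n) : symT :=
  \sum_(j < n | (j < i)%N)
     ((-1) ^+ j * d1 0 j)%:MP *: v s.-1 (~: [set i; j]) +
  \sum_(j < n | (i < j)%N)
     ((-1) ^+ j.+1 * d1 0 j)%:MP *: v s.-1 (~: [set i; j]).

Definition is_Ftop (s : nat)
    (v1 : 'rV[R]_n) (v2 : 'M[R]_n) (v3 : 'cV[R]_n) : Prop :=
  exists (ee : 'I_n -> 'I_n -> 'cV[R]_n) (ef : 'I_n -> 'I_n -> 'cV[R]_1)
         (v : nat -> {set 'I_n} -> symT) (q : 'I_n -> symT),
    (is_prod11 ee /\ is_prod12 ee ef /\ is_v3 ee v /\
     (forall i, is_sym_lift s.-1 0 (qelt s v i) (q i))) /\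
    [/\ v1 = \row_i ((-1) ^+ i * ((q i)`_s.-1)@_0%MM),
        v2 = \matrix_(i, h) ef i h 0 0
      & v3 = \col_h ((v s [set: 'I_n])`_s.-1)@_(U_(h)%MM)].

End TopComplex.

(* The complex 0 -> R^a3 -> R^a2 -> R^a1 -> R^a0, matrices acting on columns. *)
Definition acyclic_complex (R : comNzRingType) (a0 a1 a2 a3 : nat)
    (d1 : 'M[R]_(a0, a1)) (d2 : 'M[R]_(a1, a2)) (d3 : 'M[R]_(a2, a3)) : Prop :=
  (d1 *m d2 = 0 /\ d2 *m d3 = 0) /\
  [/\ forall x : 'cV[R]_a3, d3 *m x = 0 -> x = 0,
      forall x : 'cV[R]_a2, d2 *m x = 0 -> exists y, x = d3 *m y
    & forall x : 'cV[R]_a1, d1 *m x = 0 -> exists y, x = d2 *m y].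

Definition split_d1 (R : nzRingType) (m : nat) : 'rV[R]_m.+1 :=
  \row_i (i == ord_max)%:R.
Definition split_d2 (R : nzRingType) (m : nat) : 'M[R]_m.+1 :=
  \matrix_(i, h) ((h != ord_max) && (i == h))%:R.
Definition split_d3 (R : nzRingType) (m : nat) : 'cV[R]_m.+1 :=
  \col_i (i == ord_max)%:R.

Section ExplicitTop.
Variables (R : comNzRingType) (m : nat) (B : 'M[R]_m.+1).

Definition top_v1 : 'rV[R]_m.+1 :=
  \row_i (if i == ord_max then 0
          else (-1) ^+ i * pfaffian_hat B i ord_max).

(* For i, h < n the (i, h) entry is b_hi, that is - b_ih for i < h. *)
Definition top_v2 : 'M[R]_m.+1 :=
  \matrix_(i, h) (if h == ord_max then (i == ord_max)%:R else B h i).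

Definition top_v3 : 'cV[R]_m.+1 :=
  \col_i (if i == ord_max then pfaffian B
          else (-1) ^+ i.+1 * pfaffian_hat B i ord_max).

End ExplicitTop.

(* Main.v *)
Require Import Defs.
From mathcomp Require Import all_boot all_order all_fingroup all_algebra.
From mathcomp Require Import mpoly.
From mathcomp Require Import ring zify.

(** For the split complex the products are as small as possible:
    e_i . e_j = b_ij f_n + [i = n] f_j - [j = n] f_i  (lemma [is_prod11E]).
    Substituting this in the recursion for v^(3)_t, every factor
    v^(3)_(t-1)(I minus two elements, one of them max I) is a multiple of f_n,
    because max I is the only element of I that can be n.  The factor f_n that
    is divided out at each step is therefore visible, the b_ij-part of the
    recursion is the expansion of a pfaffian along its last column, and
    v^(3)_t(I) is g^(t-1) times the linear form
    Pf(I) f_n - [n in I] sum_(a >= 0) (-1)^a Pf(I minus i_a, n) f_(i_a)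
    ([v3_form], [v3_form_step]).  The three matrices are read off from this.

    Deleting the trivial last basis elements, acyclicity is exactness of
    0 -> R -> R^m -> R^m -> R, where m = n - 1 is odd, the middle map is the
    generic skew-symmetric m x m matrix and the outer maps are given by its
    signed subpfaffians pi_1, ..., pi_m.  It is proved in three steps.

    - Every pi_i annihilates the homology.  The point is a Koszul relation
      ([pf_del_koszul]): for i <> j the vector pi_j e_i - pi_i e_j lies in the
      image of the skew matrix.  Indeed Pf(l, D), with D the complement of
      {i, j}, is a linear combination of the entries of row l; it vanishes when
      l is repeated in D, and is a signed subpfaffian when l is i or j.

    - Three of the pi_i form a regular sequence ([regular_pf_del]): the ones
      that omit the first, the middle and the last of the m indices.  Their
      remaining indices are matched by the nested pairs i + j = c, for three
      consecutive values of c.  Adding to b_ij the power x_(i+j mod 3)^(n^(j-i))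
      of one of three new variables makes the longest pair dominate the degree,
      so the leading monomials of the three deformed pfaffians are powers of
      three distinct variables, hence pairwise coprime; and regularity descends
      along the retraction that sends the new variables to 0.

    - A homology class killed by a regular sequence of length 2 (middle left)
      or 3 (middle right) is zero, by diagram chase ([image_by_regular_pair],
      [image_by_regular_triple]).

    Pfaffians are handled as functions of words in the index set, defined by
    expansion along the first letter.  All their properties follow from the
    anticommutation of the contraction operators [contract_anticomm]. *)

Set Implicit Arguments.
Unset Strict Implicit.
Unset Printing Implicit Defensive.

Import Order.TTheory GRing.Theory.
Local Open Scope ring_scope.

(** * Contraction operators on functions of words *)
Section Contraction.
Variables (T : Type) (R : comNzRingType).
Implicit Types (al be : T -> R) (F G : seq T -> R) (s w : seq T).

(** The transpose of the antiderivation of the free algebra on [T] that sends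
    a letter [z] to the scalar [al z]: it is [F] evaluated on the signed sum of
    the words obtained by deleting one letter [z] of [s], weighted by [al z].
    Working with the
    transpose avoids formal linear combinations of words. *)
Fixpoint contract al F s : R :=
  if s is z :: s' then al z * F s' - contract al (fun w => F (z :: w)) s' else 0.

Lemma eq_contract al be F G s :
    al =1 be -> (forall w, (size w).+1 = size s -> F w = G w) ->
  contract al F s = contract be G s.
Proof.
move=> eq_al; elim: s F G => //= z s IHs F G eqFG.
rewrite eq_al eqFG // (IHs _ (fun w => G (z :: w))) // => w sz_w.
by apply: eqFG; rewrite /= sz_w.
Qed.

Lemma contract_lin al c d F G s :
  contract al (fun w => c * F w + d * G w) s =
    c * contract al F s + d * contract al G s.
Proof.
elim: s F G => [|z s IHs] F G /=; first by rewrite !mulr0 addr0.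
by rewrite IHs; ring.
Qed.

(** Two antiderivations anticommute.  This is what makes the pfaffian, defined
    below by iterated contraction, alternating. *)
Lemma contract_anticomm al be F s :
  contract al (contract be F) s = - contract be (contract al F) s.
Proof.
elim: s F => [|z s IHs] F /=; first by rewrite oppr0.
have E ga de : contract ga (fun w => de z * F w -
    contract de (fun w0 => F (z :: w0)) w) s =
  de z * contract ga F s - contract ga (contract de (fun w => F (z :: w))) s.
  rewrite -[X in _ - X]mul1r -mulNr -contract_lin.
  by apply: eq_contract => // w _; rewrite mulN1r.
by rewrite !E IHs; ring.
Qed.

(** Not a consequence of [contract_anticomm], as 2 may be a zero divisor. *)
Lemma contract_twice al F s : contract al (contract al F) s = 0.
Proof.
elim: s F => [|z s IHs] F //=.
transitivity (al z * contract al F s -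
  (al z * contract al F s + -1 * contract al (contract al (fun w => F (z :: w))) s)).
  congr (_ - _); rewrite -contract_lin; apply: eq_contract => // w _.
  by rewrite mulN1r.
by rewrite IHs; ring.
Qed.

Lemma contract_sum al F s (x0 : T) :
  contract al F s = \sum_(a < size s)
    (-1) ^+ a * (al (nth x0 s a) * F (take a s ++ drop a.+1 s)).
Proof.
elim: s F => [|z s IHs] F /=; first by rewrite big_ord0.
rewrite big_ord_recl /= expr0 mul1r drop0; congr (_ + _).
rewrite IHs -sumrN; apply: eq_bigr => a _.
by rewrite /bump /= add1n exprS; ring.
Qed.

Lemma contract_rcons al F s y :
  contract al F (rcons s y) =
    contract al (fun w => F (rcons w y)) s + (-1) ^+ size s * (al y * F s).
Proof.
elim: s F => [|z s IHs] F /=; first by rewrite expr0; ring.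
by rewrite IHs exprS; ring.
Qed.

Definition swap_alt F :=
  forall s1 x y s2, F (s1 ++ x :: y :: s2) = - F (s1 ++ y :: x :: s2).

Lemma contract_swap_alt al F : swap_alt F -> swap_alt (contract al F).
Proof.
move=> altF s1; elim: s1 F altF => [|u s1 IHs] F altF x y s2 /=.
  have -> : contract al (fun w => F [:: x, y & w]) s2 =
    - contract al (fun w => F [:: y, x & w]) s2.
    rewrite -[RHS]addr0 -mulN1r -[X in _ + X](mul0r (contract al F s2)).
    rewrite -contract_lin; apply: eq_contract => // w _.
    by rewrite (altF [::]) /= mul0r addr0 mulN1r.
  ring.
rewrite (IHs (fun w => F (u :: w))); first by rewrite altF; ring.
by move=> s1' x' y' s2'; rewrite -!cat_cons altF.
Qed.

End Contraction.

(** * Pfaffians of words *)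
Section Words.
Variables (T : Type) (R : comNzRingType) (A : T -> T -> R).

(** Expansion along the first letter; [k] is fuel, any [k >= size s] will do. *)
Fixpoint pfword_rec k s : R :=
  if s is x :: s' then
    if k is k'.+1 then contract (A x) (pfword_rec k') s' else 0
  else 1.

Definition pfword s := pfword_rec (size s) s.

Lemma pfword_recE k s : (size s <= k)%N -> pfword_rec k s = pfword s.
Proof.
rewrite /pfword; have [n] := ubnP (size s).
elim: n k s => // n IHn [|k] [|x s] //= lt_s_n le_s_k.
apply: eq_contract => // w sz_w.
have le_w : (size w <= size s)%N by rewrite -sz_w.
have lt_w : (size w < n)%N by rewrite sz_w ltnW.
by rewrite (IHn k) ?(IHn (size s)) // (leq_trans le_w).
Qed.

Lemma pfword_nil : pfword [::] = 1. Proof. by []. Qed.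

Lemma pfword_cons x s : pfword (x :: s) = contract (A x) pfword s.
Proof.
rewrite {1}/pfword /=; apply: eq_contract => // w sz_w.
by rewrite pfword_recE // -sz_w leqnSn.
Qed.

Hypothesis altA : forall x y, A y x = - A x y.

(** A swap beyond the first letter is inherited from the contracted words; for
    a swap of the first two letters the expansion has one term with the entry
    of [A] at these letters, and a double contraction that anticommutes. *)
Lemma pfword_rec_swap_alt k : swap_alt (pfword_rec k).
Proof.
elim: k => [|k IHk] [|z s1] x y s2 /=; rewrite ?oppr0 //; last first.
  exact: contract_swap_alt.
have E u v s : contract (A u) (fun w => pfword_rec k (v :: w)) s =
    contract (A u) (if k is k'.+1 then contract (A v) (pfword_rec k')
                    else fun=> 0) s.
  by case: k {IHk}.
rewrite !E altA; case: k {IHk E} => [|k]; last by rewrite contract_anticomm; ring.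
have C0 u : contract (A u) (fun=> 0) s2 = 0.
  have := contract_lin (A u) 0 0 (fun=> 0) (fun=> 0) s2.
  by rewrite !mul0r !addr0.
by rewrite !C0; ring.
Qed.

Lemma pfword_swap s1 x y s2 :
  pfword (s1 ++ x :: y :: s2) = - pfword (s1 ++ y :: x :: s2).
Proof.
by rewrite /pfword !size_cat; apply: pfword_rec_swap_alt.
Qed.

(** With [pfword_cons], this gives the expansion along any letter. *)
Lemma pfword_to_front s1 x s2 :
  pfword (s1 ++ x :: s2) = (-1) ^+ size s1 * pfword (x :: s1 ++ s2).
Proof.
elim/last_ind: s1 s2 => [|s1 y IHs] s2; first by rewrite mul1r.
by rewrite cat_rcons pfword_swap IHs cat_rcons size_rcons exprS; ring.
Qed.

Lemma pfword_rcons s x : odd (size s) ->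
  pfword (rcons s x) = - pfword (x :: s).
Proof.
by move=> odd_s; rewrite -cats1 pfword_to_front cats0 -signr_odd odd_s expr1 mulN1r.
Qed.

Hypothesis nullA : forall x, A x x = 0.

Lemma pfword_repeat s1 x s2 : pfword (x :: s1 ++ x :: s2) = 0.
Proof.
suff E s : pfword [:: x, x & s] = 0.
  by rewrite -cat_cons pfword_to_front /= E mulr0.
rewrite pfword_cons /= nullA mul0r sub0r.
rewrite (_ : contract _ _ s = contract (A x) (contract (A x) pfword) s).
  by rewrite contract_twice oppr0.
by apply: eq_contract => // w _; rewrite pfword_cons.
Qed.

End Words.

Lemma rmorph_pfword (T : Type) (R R' : comNzRingType) (f : {rmorphism R -> R'})
    (A : T -> T -> R) s :
  f (pfword A s) = pfword (fun i j => f (A i j)) s.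
Proof.
have C al (F : seq T -> R) w : f (contract al F w) = contract (f \o al) (f \o F) w.
  by elim: w F => [|z w IHw] F /=; rewrite ?rmorph0 // rmorphB rmorphM IHw.
rewrite /pfword; move: (size s) => k.
elim: k s => [|k IHk] [|x s] //=; rewrite ?rmorph0 ?rmorph1 //.
by rewrite C; apply: eq_contract => // w _; apply: IHk.
Qed.

Lemma eq_pfword (T : Type) (R : comNzRingType) (A A' : T -> T -> R) s :
  (forall i j, A i j = A' i j) -> pfword A s = pfword A' s.
Proof.
move=> eqA; rewrite /pfword; move: (size s) => k.
elim: k s => [|k IHk] [|x s] //=.
by apply: eq_contract => // w _; apply: IHk.
Qed.

(** * Expansion of the sum over perfect matchings along the first row *)
Lemma lift_permP n (i : 'I_n.+1) (s : 'S_n.+1) :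
  exists s' : 'S_n, s = lift_perm i (s i) s'.
Proof.
pose f k := odflt k (unlift (s i) (s (lift i k))).
have fK k : lift (s i) (f k) = s (lift i k).
  rewrite /f; have := neq_lift i k.
  by rewrite -(can_eq (permK s)) => /unlift_some[] ? ? ->.
have inj_f : injective f.
  by move=> k k' eq_f; apply/(@lift_inj _ i)/(@perm_inj _ s); rewrite -!fK eq_f.
exists (perm inj_f); apply/permP => k.
case: (unliftP i k) => [k'|] ->; rewrite ?lift_perm_id //.
by rewrite lift_perm_lift permE fK.
Qed.

Lemma lift_perm_inj n (i j : 'I_n.+1) : injective (lift_perm i j).
Proof.
move=> s s' eq_s; apply/permP => k; apply: (@lift_inj _ j).
by rewrite -!(lift_perm_lift i) eq_s.
Qed.

(** Adds the pair formed by 0 and [lift ord0 p.1] in front of the matching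
    [p.2] of the remaining points. *)
Definition matching_cons k (p : 'I_k.+1 * 'S_k) : 'S_k.+2 :=
  lift_perm ord0 ord0 (lift_perm ord0 p.1 p.2).

Lemma matching_cons_inj k : injective (@matching_cons k).
Proof.
case=> c s [c' s'] /lift_perm_inj /= eq_p.
have eq_c : c = c' by rewrite -(lift_perm_id ord0 c s) eq_p lift_perm_id.
by rewrite eq_c in eq_p *; rewrite (lift_perm_inj eq_p).
Qed.

Lemma matching_cons0 k (p : 'I_k.+1 * 'S_k) : matching_cons p ord0 = ord0.
Proof. exact: lift_perm_id. Qed.

Lemma matching_cons1 k (p : 'I_k.+1 * 'S_k) :
  matching_cons p (lift ord0 ord0) = lift ord0 p.1.
Proof. by rewrite lift_perm_lift lift_perm_id. Qed.

Lemma matching_cons_lift k (p : 'I_k.+1 * 'S_k) a :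
  matching_cons p (lift ord0 (lift ord0 a)) = lift ord0 (lift p.1 (p.2 a)).
Proof. by rewrite !lift_perm_lift. Qed.

Lemma odd_matching_cons k (p : 'I_k.+1 * 'S_k) :
  matching_cons p = odd p.1 (+) p.2 :> bool.
Proof. by rewrite /matching_cons !odd_lift_perm. Qed.

Lemma fst_of0 k : @fst_of k.+2 ord0 = ord0.
Proof. exact: val_inj. Qed.

Lemma snd_of0 k : @snd_of k.+2 ord0 = lift ord0 ord0.
Proof. exact: val_inj. Qed.

Lemma fst_of_lift k (a : 'I_(k./2)) :
  @fst_of k.+2 (lift ord0 a) = lift ord0 (lift ord0 (fst_of a)).
Proof. exact: val_inj. Qed.

Lemma snd_of_lift k (a : 'I_(k./2)) :
  @snd_of k.+2 (lift ord0 a) = lift ord0 (lift ord0 (snd_of a)).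
Proof. exact: val_inj. Qed.

Lemma ltn_lift n (i : 'I_n.+1) (j k : 'I_n) : (lift i j < lift i k)%N = (j < k)%N.
Proof. by rewrite /= ltnNge leq_bump2 -ltnNge. Qed.

Lemma forall_ordS n (P : pred 'I_n.+1) :
  [forall a, P a] = P ord0 && [forall a, P (lift ord0 a)].
Proof.
apply/forallP/andP => [allP | [P0 /forallP PS] a].
  by split=> //; apply/forallP => a.
by case: (unliftP ord0 a) => [a'|] ->.
Qed.

Lemma matching_perm_cons k (p : 'I_k.+1 * 'S_k) :
  matching_perm (matching_cons p) = matching_perm p.2.
Proof.
rewrite /matching_perm /=; congr (_ && _).
  rewrite forall_ordS fst_of0 snd_of0 matching_cons0 matching_cons1 /=.
  apply: eq_forallb => a.
  by rewrite fst_of_lift snd_of_lift !matching_cons_lift !ltn_lift.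
rewrite forall_ordS; apply/andP/forallP => [[_ /forallP allP] a | allP].
  apply/forallP => c; have /forallP/(_ (lift ord0 c)) := allP a.
  by rewrite !fst_of_lift !matching_cons_lift !ltn_lift.
split; first apply/forallP => c.
  rewrite fst_of0 matching_cons0; case: (unliftP ord0 c) => [c'|] -> //.
  by rewrite fst_of_lift matching_cons_lift.
apply/forallP => a; rewrite forall_ordS /=; apply/forallP => c.
have /forallP/(_ c) := allP a.
by rewrite !fst_of_lift !matching_cons_lift !ltn_lift.
Qed.

(** The point 0 cannot be the larger element of its pair, and the smaller
    elements of the pairs are listed in increasing order. *)
Lemma matching_perm0 k (s : 'S_k.+2) : ~~ odd k -> matching_perm s -> s ord0 = ord0.
Proof.
move=> even_k /andP[/forallP lt_s /forallP incr_s].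
have [p sp] : exists p, s p = ord0 by exists ((s^-1)%g ord0); rewrite permKV.
have lt_p : (p./2 < k.+2./2)%N.
  by rewrite ltn_half_double -[X in X.*2]/(k./2.+1) doubleS even_halfK.
have := odd_double_half p; case: (odd p) => /= def_p.
  have := lt_s (Ordinal lt_p); rewrite (_ : snd_of _ = p) ?sp //.
  exact: val_inj.
have fst_p : fst_of (Ordinal lt_p) = p by apply: val_inj.
have /forallP/(_ (Ordinal lt_p)) := incr_s ord0.
rewrite fst_p sp ltn0 implybF -leqNgt leqn0 /= => /eqP half_p.
have p0 : p = ord0 by apply: val_inj; rewrite /= -def_p half_p.
by rewrite -{1}p0.
Qed.

Lemma matching_consP k (s : 'S_k.+2) : s ord0 = ord0 -> exists p, s = matching_cons p.
Proof.
move=> s0; have [s1 ->] := lift_permP ord0 s; have [s2 def_s1] := lift_permP ord0 s1.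
by exists (s1 ord0, s2); rewrite /matching_cons -def_s1 s0.
Qed.

(** The matchings in normal form are the [matching_cons p] with [p.2] in normal
    form, and [lift_perm] contributes the sign [(-1) ^+ p.1]. *)
Lemma pfaffian_expand (R : comNzRingType) k (A : 'M[R]_k.+2) :
  pfaffian A = \sum_(c < k.+1) (-1) ^+ c * (A ord0 (lift ord0 c) *
    pfaffian (\matrix_(a, b) A (lift ord0 (lift c a)) (lift ord0 (lift c b)))).
Proof.
rewrite /pfaffian /= negbK; case: ifPn => [_ | even_k].
  by rewrite big1 // => c _; rewrite !mulr0.
pose h' (s : 'S_k.+2) : 'I_k.+1 * 'S_k := odflt (ord0, 1%g) [pick p | matching_cons p == s].
rewrite (reindex_onto (@matching_cons k) h') /=; last first.
  move=> s /(matching_perm0 even_k)/matching_consP[p ->].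
  by rewrite /h'; case: pickP => [p' /eqP // | /(_ p)]; rewrite eqxx.
under [RHS]eq_bigr do rewrite !big_distrr /=.
rewrite pair_big_dep /=; apply: eq_big => [p | p _].
  rewrite matching_perm_cons /h'; case: pickP => [p' /eqP/matching_cons_inj -> | /(_ p)].
    by rewrite eqxx andbT.
  by rewrite eqxx.
rewrite odd_matching_cons signr_addb (signr_odd _ p.1).
rewrite -!mulrA; congr (_ * _).
rewrite big_ord_recl fst_of0 snd_of0 matching_cons0 matching_cons1 mulrCA.
congr (_ * (_ * _)).
apply: eq_bigr => a _.
by rewrite mxE fst_of_lift snd_of_lift !matching_cons_lift.
Qed.

Lemma nth_rem_at (T : Type) (x0 : T) s c a : (c < size s)%N ->
  nth x0 (take c s ++ drop c.+1 s) a = nth x0 s (bump c a).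
Proof.
move=> lt_c; rewrite nth_cat size_take lt_c /bump; case: ltnP => lt_a.
  by rewrite nth_take.
by rewrite nth_drop add1n addSn subnKC.
Qed.

Lemma pfaffian_word (T : Type) (R : comNzRingType) (A : T -> T -> R) (x0 : T) s k
    (M : 'M[R]_k) :
  size s = k -> (forall a c, M a c = A (nth x0 s a) (nth x0 s c)) ->
  pfaffian M = pfword A s.
Proof.
have [n] := ubnP k; elim: n k s M => // n IHn [|[|k]] s M lt_k.
- case: s => // _ _; rewrite /pfaffian /= (bigD1 1%g) /=; last first.
    by apply/andP; split; apply/forallP => -[].
  rewrite odd_perm1 mul1r big_ord0 big1 ?addr0 // => s /andP[_ /eqP[]].
  by apply/permP => -[].
- by case: s => [|x []] // _ _; rewrite pfword_cons.
case: s => // x s [sz_s] defM.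
rewrite pfaffian_expand pfword_cons (contract_sum _ _ _ x0) sz_s.
apply: eq_bigr => c _; rewrite defM; congr (_ * (_ * _)).
have lt_c : (c < size s)%N by rewrite sz_s.
apply: IHn; first exact: ltnW.
  by rewrite size_cat size_take lt_c size_drop sz_s subSS subnKC // -ltnS.
by move=> a b; rewrite mxE defM !nth_rem_at.
Qed.

(** * Regular sequences from coprime leading monomials *)
(** [a] is regular modulo [b]; the order is that of the equation [a u = b v]. *)
Definition regular_pair (R : comNzRingType) (a b : R) :=
  forall u v, a * u = b * v -> exists w, u = b * w.

(** [c] is regular modulo the ideal [(a, b)]. *)
Definition regular_mod_pair (R : comNzRingType) (a b c : R) :=
  forall p u v, c * p = a * u + b * v -> exists u' v', p = a * u' + b * v'.

Section LeadingMonomials.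
Variables (n : nat) (R : idomainType).
Implicit Types (a b c p q u v : {mpoly R[n]}) (k l m : 'X_{1..n}).

(** One division step.  A zero remainder is a separate outcome: [mlead 0] is the
    least monomial and need not be less than [mlead p]. *)
Lemma lead_reduce a p : mleadc a = 1 -> p != 0 -> (mlead a <= mlead p)%MM ->
  exists t, (p - t * a == 0) || (mlead (p - t * a) < mlead p)%O.
Proof.
move=> lc_a nz_p le_ap; exists (mleadc p *: 'X_[mlead p - mlead a]).
set t := _ *: _; set q := p - _; case: eqVneq => //= nz_q.
have lead_t : mlead t = (mlead p - mlead a)%MM.
  by rewrite mleadZ ?mleadc_eq0 // mleadXm.
have lc_t : mleadc t = mleadc p by rewrite mleadcZE mleadXm mcoeffX eqxx mulr1.
have lead_ta : (mlead t + mlead a)%MM = mlead p by rewrite lead_t submK.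
have coef0 : q@_(mlead p) = 0.
  by rewrite mcoeffB -{2}lead_ta mleadcM lc_t lc_a mulr1 subrr.
rewrite lt_neqAle; apply/andP; split.
  by apply: contraNneq nz_q => eq_q; rewrite -mleadc_eq0 eq_q coef0.
apply: (le_trans (mleadB_le _ _)); rewrite leUx lexx /=.
by rewrite -lead_ta mleadM_le.
Qed.

Definition mnm_coprime k l := forall i, (k i == 0%N) || (l i == 0%N).

Lemma mnm_coprime_le k l m : mnm_coprime k l -> (k <= l + m)%MM -> (k <= m)%MM.
Proof.
move=> cop_kl /mnm_lepP le_k; apply/mnm_lepP => i.
by have := le_k i; rewrite mnmDE; case/orP: (cop_kl i) => /eqP ->.
Qed.

Lemma lead_neq0 a : mleadc a = 1 -> a != 0.
Proof. by rewrite -mleadc_eq0 => ->; rewrite oner_eq0. Qed.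

(** In [a u = b v] the leading monomial of [b] divides that of [u], so that
    [u] can be reduced modulo [b]; the relation is preserved. *)
Lemma regular_pair_lead a b : mleadc a = 1 -> mleadc b = 1 ->
  mnm_coprime (mlead b) (mlead a) -> regular_pair a b.
Proof.
move=> lc_a lc_b cop u; have [nz_a nz_b] := (lead_neq0 lc_a, lead_neq0 lc_b).
elim/mleadrect: u => u IHu v eq_uv.
have [-> | nz_u] := eqVneq u 0; first by exists 0; rewrite mulr0.
have nz_v : v != 0.
  by apply: contra_eq_neq eq_uv => ->; rewrite mulr0 mulf_neq0.
have le_bu : (mlead b <= mlead u)%MM.
  apply: (mnm_coprime_le cop); rewrite -mleadM // eq_uv mleadM //.
  by apply/mnm_lepP => i; rewrite mnmDE leq_addr.
have [t /orP[/eqP def_u | lt_u]] := lead_reduce lc_b nz_u le_bu.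
  by exists t; rewrite mulrC; apply/subr0_eq.
have [] := IHu _ lt_u (v - t * a).
  by rewrite !mulrBr eq_uv; ring.
by move=> w def_w; exists (w + t); rewrite mulrDr -def_w; ring.
Qed.

(** Buchberger's first criterion: [a] and [b] form a Groebner basis.  When the
    leading terms of [a u] and [b v] could cancel, the Koszul relation
    [a b - b a = 0] rewrites the combination with a smaller [u]. *)
Lemma lead_ideal2 a b u v : mleadc a = 1 -> mleadc b = 1 ->
  mnm_coprime (mlead b) (mlead a) -> a * u + b * v != 0 ->
  (mlead a <= mlead (a * u + b * v))%MM \/ (mlead b <= mlead (a * u + b * v))%MM.
Proof.
move=> lc_a lc_b cop; have [nz_a nz_b] := (lead_neq0 lc_a, lead_neq0 lc_b).
have leM c w : c != 0 -> w != 0 -> (mlead c <= mlead (c * w))%MM.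
  by move=> nz_c nz_w; rewrite mleadM //; apply/mnm_lepP => i; rewrite mnmDE leq_addr.
elim/mleadrect: u v => u IHu v nz_f.
have [u0 | nz_u] := eqVneq u 0.
  rewrite u0 mulr0 add0r in nz_f *; right; apply: leM => //.
  by apply: contraNneq nz_f => ->; rewrite mulr0.
have [v0 | nz_v] := eqVneq v 0.
  by rewrite v0 mulr0 addr0; left; apply: leM.
case: (ltgtP (mlead (a * u)) (mlead (b * v))) => [lt_m | gt_m | eq_m].
- by right; rewrite mleadDr // leM.
- by left; rewrite mleadDl // leM.
have le_bu : (mlead b <= mlead u)%MM.
  by apply: (mnm_coprime_le cop); rewrite -mleadM // eq_m leM.
have [t] := lead_reduce lc_b nz_u le_bu.
have eq_f : a * u + b * v = a * (u - t * b) + b * (v + t * a) by ring.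
rewrite eq_f in nz_f *; case/orP=> [/eqP u0 | lt_u]; last exact: IHu.
rewrite u0 mulr0 add0r in nz_f *; right; apply: leM => //.
by apply: contraNneq nz_f => ->; rewrite mulr0.
Qed.

Lemma regular_mod_pair_lead a b c :
    mleadc a = 1 -> mleadc b = 1 -> mleadc c = 1 ->
    mnm_coprime (mlead b) (mlead a) -> mnm_coprime (mlead a) (mlead c) ->
    mnm_coprime (mlead b) (mlead c) ->
  regular_mod_pair a b c.
Proof.
move=> lc_a lc_b lc_c cop_ba cop_ac cop_bc p; have nz_c := lead_neq0 lc_c.
elim/mleadrect: p => p IHp u v eq_p.
have [-> | nz_p] := eqVneq p 0; first by exists 0, 0; rewrite !mulr0 addr0.
have nz_cp : c * p != 0 by rewrite mulf_neq0.
have := lead_ideal2 lc_a lc_b cop_ba; move=> /(_ u v); rewrite -eq_p => /(_ nz_cp).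
rewrite mleadM // => -[/(mnm_coprime_le cop_ac) | /(mnm_coprime_le cop_bc)] le_p.
  have [t /orP[/eqP p0 | lt_p]] := lead_reduce lc_a nz_p le_p.
    by exists t, 0; rewrite (subr0_eq p0); ring.
  have [] := IHp _ lt_p (u - c * t) v; first by rewrite mulrBr eq_p; ring.
  move=> u' [v' def_p]; exists (u' + t), v'.
  by rewrite mulrDr addrAC -def_p; ring.
have [t /orP[/eqP p0 | lt_p]] := lead_reduce lc_b nz_p le_p.
  by exists 0, t; rewrite (subr0_eq p0); ring.
have [] := IHp _ lt_p u (v - c * t); first by rewrite mulrBr eq_p; ring.
move=> u' [v' def_p]; exists u', (v' + t).
by rewrite mulrDr addrA -def_p; ring.
Qed.

End LeadingMonomials.

(** Regularity is tested after a split embedding [f]: the retraction [g] brings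
    the quotients back. *)
Section Retract.
Variables (R S : comNzRingType) (f : {rmorphism R -> S}) (g : {rmorphism S -> R}).
Hypothesis fK : cancel f g.

Lemma regular_pair_retract a b : regular_pair (f a) (f b) -> regular_pair a b.
Proof.
move=> reg u v eq_uv.
have [|w def_u] := reg (f u) (f v); first by rewrite -!rmorphM eq_uv.
by exists (g w); rewrite -[u]fK def_u rmorphM fK.
Qed.

Lemma regular_mod_pair_retract a b c :
  regular_mod_pair (f a) (f b) (f c) -> regular_mod_pair a b c.
Proof.
move=> reg p u v eq_p.
have [|u' [v' def_p]] := reg (f p) (f u) (f v).
  by rewrite -!rmorphM -rmorphD eq_p.
by exists (g u'), (g v'); rewrite -[p]fK def_p rmorphD !rmorphM !fK.
Qed.

End Retract.

(** * Leading terms of pfaffians of nested matchings *)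
Section Degree.
Variables (k : nat) (R : idomainType).
Implicit Types (p q : {mpoly R[k]}).

Lemma msizeM_bound d e p q :
  (msize p <= d.+1)%N -> (msize q <= e)%N -> (msize (p * q) <= d + e)%N.
Proof.
have [-> | nz_p] := eqVneq p 0; first by rewrite mul0r msize0.
have [-> | nz_q] := eqVneq q 0; first by rewrite mulr0 msize0.
rewrite msizeM //; lia.
Qed.

Lemma msizeD_bound d p q :
  (msize p <= d)%N -> (msize q <= d)%N -> (msize (p + q) <= d)%N.
Proof. by move=> le_p le_q; rewrite (leq_trans (msizeD_le _ _)) // geq_max le_p. Qed.

Lemma msize_sign e p : msize ((-1) ^+ e * p) = msize p.
Proof. by rewrite -signr_odd; case: odd; rewrite ?mulN1r ?msizeN ?mul1r. Qed.

Lemma msize_contract (T : eqType) (al : T -> {mpoly R[k]}) F s d e :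
    {in s, forall z, (msize (al z) <= d.+1)%N} ->
    (forall w, {subset w <= s} -> (size w < size s)%N -> (msize (F w) <= e)%N) ->
  (msize (contract al F s) <= d + e)%N.
Proof.
elim: s F => [|z s IHs] F le_al le_F /=; first by rewrite msize0.
apply: msizeD_bound.
  apply: msizeM_bound; first by apply: le_al; rewrite mem_head.
  by apply: le_F => // y s_y; rewrite inE s_y orbT.
rewrite msizeN; apply: IHs => [y s_y | w sub_ws lt_w].
  by apply: le_al; rewrite inE s_y orbT.
apply: le_F => // y; rewrite !inE => /predU1P[-> | /sub_ws ->]; rewrite ?eqxx ?orbT //.
Qed.

Lemma msize_pfword (T : eqType) (A : T -> T -> {mpoly R[k]}) s d :
    {in s &, forall x y, (msize (A x y) <= d.+1)%N} ->
  (msize (pfword A s) <= (d * size s).+1)%N.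
Proof.
have [n] := ubnP (size s); elim: n s => // n IHn [|x s] lt_n le_A.
  by rewrite pfword_nil muln0 msize1.
rewrite pfword_cons /= mulnS -addnS; apply: msize_contract => [z s_z | w sub_ws lt_w].
  by apply: le_A; rewrite inE ?eqxx ?s_z ?orbT.
apply: (@leq_trans (d * size w).+1); last by rewrite ltnS leq_mul2l ltnW ?orbT.
apply: IHn => [|y z /sub_ws s_y /sub_ws s_z]; first exact: ltn_trans lt_w lt_n.
by apply: le_A; rewrite inE ?s_y ?s_z orbT.
Qed.

(** Up to sign, the part of [p] of degree at least [D] is a pure power. *)
Definition has_top (v : 'I_k) D p :=
  exists e : nat, (msize (p - (-1) ^+ e * 'X_[U_(v) *+ D]) <= D)%N.

Lemma has_top_lead v D p : has_top v D p ->
  exists e : nat, mleadc ((-1) ^+ e * p) = 1 /\ mlead ((-1) ^+ e * p) = (U_(v) *+ D)%MM.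
Proof.
case=> e le_D; exists e; set q := _ * p.
have lt_r : (msize (q - 'X_[U_(v) *+ D]) <= D)%N.
  by rewrite -(msize_sign e) mulrBr /q signrMK.
have sz_X : mdeg (U_(v) *+ D) = D by rewrite mdegMn mdeg1 mul1n.
have -> : q = (q - 'X_[U_(v) *+ D]) + 'X_[U_(v) *+ D] by rewrite subrK.
set r := q - _ in lt_r *.
have nsupp_r m : (D <= mdeg m)%N -> r@_m = 0.
  by move=> le_m; apply/memN_msupp_eq0/msize_mdeg_ge/(leq_trans lt_r).
have [-> | nz_r] := eqVneq r 0.
  by rewrite add0r mleadXm mcoeffX eqxx.
have -> : mlead (r + 'X_[U_(v) *+ D]) = (U_(v) *+ D)%MM.
  rewrite mleadDr mleadXm // lt_mdeg_ltmc // sz_X.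
  by rewrite (leq_trans _ lt_r) // mlead_deg.
by rewrite mcoeffD mcoeffX eqxx nsupp_r ?sz_X // add0r.
Qed.

End Degree.

Section Nested.
Variables (n : nat) (R : idomainType) (A : 'I_n -> 'I_n -> R).

(** The exponent [n ^ (j - i)] makes one long pair outweigh any matching that
    consists of shorter pairs; the variable records [i + j] modulo 3. *)
Definition deform (i j : 'I_n) : {mpoly R[3]} :=
  (A i j)%:MP +
  if (i < j)%N then 'X_[U_(inZp (i + j)) *+ n ^ (j - i)] else
  if (j < i)%N then - 'X_[U_(inZp (i + j)) *+ n ^ (i - j)] else 0.

Lemma msize_deform d (i j : 'I_n) :
  (i - j <= d)%N -> (j - i <= d)%N -> (msize (deform i j) <= (n ^ d).+1)%N.
Proof.
have n_gt0 : (0 < n)%N by apply: leq_ltn_trans (ltn_ord i).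
move=> le_ij le_ji; apply: msizeD_bound; first by rewrite msizeC; case: (_ != _).
case: ifP => _; last case: ifP => _; rewrite ?msize0 ?msizeN //;
  by rewrite msizeX mdegMn mdeg1 mul1n ltnS leq_pexp2l.
Qed.

(** When [s] is symmetric under [i |-> c - i], the top term comes from the
    nested matching: expanding along the first letter [x], all terms but the
    one that pairs it with the last letter [y] only involve entries of pairs
    shorter than [y - x], and too few of them to reach degree [n ^ (y - x)]. *)
Lemma top_pfword_nested c (s : seq 'I_n) :
    ~~ odd (size s) -> sorted ltn [seq val i | i <- s] ->
    rev [seq val i | i <- s] = [seq (c - val i)%N | i <- s] ->
    {in s, forall i, val i <= c}%N ->
  exists D, has_top (inZp c) D (pfword deform s).
Proof.
have [N] := ubnP (size s); elim: N s => // N IHN [|x s].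
  by exists 0%N, 0%N; rewrite pfword_nil mulm0n mpolyX0 expr0 mulr1 subrr msize0.
case/lastP: s => // s y; rewrite /= size_rcons /= negbK => lt_N even_s.
rewrite map_rcons rev_cons rev_rcons /= => srt_s [].
rewrite map_rcons => def_y /rcons_inj[rev_s def_x] le_c.
have [D0 [e0 top_s]] : exists D, has_top (inZp c) D (pfword deform s).
  apply: IHN => //; first by rewrite -ltnS ltnW.
    move: srt_s; rewrite -cats1 cat_path => /andP[/path_sorted //].
  by move=> i s_i; apply: le_c; rewrite inE mem_rcons inE s_i !orbT.
have := le_c x; rewrite mem_head => /(_ isT) /= le_xc.
have [lt_xy lt_xs lt_sy]: [/\ (x < y)%N, {in s, forall z : 'I_n, x < z}%N
    & {in s, forall z : 'I_n, z < y}%N].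
  move: srt_s; rewrite (path_sortedE ltn_trans) all_rcons => /andP[/andP[lt_xy /allP lt_xs]].
  rewrite -rev_sorted rev_rcons /= path_sortedE; last first.
    by move=> a b d /= lt1 lt2; apply: ltn_trans lt2 lt1.
  case/andP => /allP lt_sy _; split=> // z s_z.
    by apply: (lt_xs z); rewrite map_f.
  by apply: (lt_sy z); rewrite mem_rev map_f.
set L := (y - x)%N; have L_gt0 : (0 < L)%N by rewrite subn_gt0.
have n_gt0 : (0 < n)%N by apply: leq_ltn_trans (ltn_ord x).
have le_sz : (size s + 2 <= n)%N.
  have : uniq (x :: rcons s y).
    rewrite -(map_inj_uniq val_inj) /= map_rcons.
    exact: (@sorted_uniq _ ltn ltn_trans ltnn (val x :: rcons (map val s) (val y))).
  by move/card_uniqP => /= sz; rewrite -[n in leqRHS]card_ord addn2 -(size_rcons s y) -sz max_card.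
exists (n ^ L + D0)%N, e0.
rewrite pfword_cons contract_rcons -signr_odd (negPf even_s) mul1r.
set P1 := contract _ _ _.
(* The terms in which [x] is not paired with [y]. *)
have le_P1 : (msize P1 <= n ^ L)%N.
  apply: (@leq_trans (n ^ L.-1 + (n ^ L.-1 * size s).+1)); last first.
    rewrite addnS -mulnS -[in leqRHS](prednK L_gt0) expnS.
    have : (0 < n ^ L.-1)%N by rewrite expn_gt0 n_gt0.
    move: (n ^ L.-1)%N => E; nia.
  apply: msize_contract => [z s_z | w sub_ws lt_w].
    have := lt_xs _ s_z; have := lt_sy _ s_z => lt1 lt2.
    apply: msize_deform; rewrite /L; lia.
  apply: (@leq_trans (n ^ L.-1 * size (rcons w y)).+1).
    apply: msize_pfword => u v; rewrite !mem_rcons !inE => in_u in_v.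
    have [lt_xu le_uy] : (x < u)%N /\ (u <= y)%N.
      by case/predU1P: in_u => [-> // | /sub_ws s_u]; rewrite lt_xs // ltnW // lt_sy.
    have [lt_xv le_vy] : (x < v)%N /\ (v <= y)%N.
      by case/predU1P: in_v => [-> // | /sub_ws s_v]; rewrite lt_xs // ltnW // lt_sy.
    by apply: msize_deform; rewrite /L; lia.
  by rewrite size_rcons ltnS leq_mul2l lt_w orbT.
have -> : deform x y = (A x y)%:MP + 'X_[U_(inZp c) *+ n ^ L].
  rewrite /deform lt_xy (_ : (x + y)%N = c) //.
  by rewrite def_y /= subnKC.
set r := _ - _ in top_s.
have -> : pfword deform s = r + (-1) ^+ e0 * 'X_[U_(inZp c) *+ D0] by rewrite subrK.
have -> : (U_(inZp c) *+ (n ^ L + D0) = U_(inZp c) *+ n ^ L + U_(inZp c) *+ D0 :> 'X_{1..3})%MM.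
  by apply/mnmP => i; rewrite mnmDE !mulmnE mulnDr.
rewrite mpolyXD.
have nL_gt0 : (0 < n ^ L)%N by rewrite expn_gt0 n_gt0.
set X := 'X_[_ *+ n ^ L]; set Y := 'X_[_ *+ D0].
have sz_X : msize X = (n ^ L).+1 by rewrite msizeX mdegMn mdeg1 mul1n.
have sz_Y : msize Y = D0.+1 by rewrite msizeX mdegMn mdeg1 mul1n.
have sz_c : (msize (A x y)%:MP_[3] <= 1)%N by rewrite msizeC; case: (_ != _).
have -> : P1 + ((A x y)%:MP + X) * (r + (-1) ^+ e0 * Y) - (-1) ^+ e0 * (X * Y) =
  P1 + (X * r + ((A x y)%:MP * (r + (-1) ^+ e0 * Y))) by ring.
apply: msizeD_bound; first by rewrite (leq_trans le_P1) ?leq_addr.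
apply: msizeD_bound; first by apply: msizeM_bound => //; rewrite sz_X.
apply: (@leq_trans (0 + D0.+1)); last by rewrite add0n -add1n leq_add2r.
apply: msizeM_bound => //; apply: msizeD_bound; first exact: ltnW.
by rewrite msize_sign sz_Y.
Qed.

End Nested.

(** * Subpfaffians annihilate the homology *)
Section Annihilation.
Variables (T : finType) (R : comNzRingType).

Lemma contract_scalars (F : seq T -> R) s :
  exists w : T -> R, (forall h, h \notin s -> w h = 0) /\
    forall al, contract al F s = \sum_h al h * w h.
Proof.
elim: s F => [|z s IHs] F.
  by exists (fun=> 0); split=> // al; rewrite big1 // => h _; rewrite mulr0.
have [w [w0 def_c]] := IHs (fun w => F (z :: w)).
exists (fun h => (h == z)%:R * F s - w h); split=> [h | al /=].
  by rewrite inE => /norP[/negPf-> /w0->]; rewrite mul0r subr0.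
rewrite def_c [RHS](eq_bigr (fun h => (h == z)%:R * (al h * F s) - al h * w h)).
  rewrite sumrB; congr (_ - _).
  by rewrite (bigD1 z) //= eqxx mul1r big1 ?addr0 // => h /negPf->; rewrite mul0r.
by move=> h _; ring.
Qed.

Lemma contract_uniq (al : T -> R) F s : uniq s ->
  contract al F s = \sum_(h in s) (-1) ^+ index h s * (al h * F (rem h s)).
Proof.
move=> uniq_s; rewrite -[RHS]big_uniq //.
case: s uniq_s => [|x0 s'] uniq_s; first by rewrite big_nil.
rewrite (contract_sum _ _ _ x0) [RHS](big_nth x0) big_mkord.
by apply: eq_bigr => a _; rewrite remE index_uniq // ltn_ord.
Qed.

Variables (A : T -> T -> R) (L : seq T).
Hypotheses (altA : forall x y, A y x = - A x y) (nullA : forall x, A x x = 0).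
Hypothesis uniqL : uniq L.

(** The coordinates of the kernel vector of a skew matrix of odd size. *)
Definition pf_del i := (-1) ^+ index i L * pfword A (rem i L).

Lemma pfword_cons_sum l : pfword A (l :: L) = \sum_(h in L) A l h * pf_del h.
Proof.
rewrite pfword_cons contract_uniq //; apply: eq_bigr => h _.
by rewrite /pf_del mulrCA.
Qed.

(** The sum expands the pfaffian of a word in which [l] is repeated. *)
Lemma pf_del_kernel l : l \in L -> \sum_(h in L) A l h * pf_del h = 0.
Proof.
move=> L_l; rewrite -pfword_cons_sum; case/splitPr: L_l => s1 s2.
exact: pfword_repeat.
Qed.

(** The vector [w] consists of the coefficients of the entries of row [l] in
    the pfaffian of [l :: D], where [D] is [L] without [i] and [j]. *)
Lemma pf_del_koszul i j : i \in L -> j \in L -> i != j ->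
  exists w : T -> R, (forall h, h \notin L -> w h = 0) /\
    forall l, l \in L ->
      \sum_h A l h * w h = (l == i)%:R * pf_del j - (l == j)%:R * pf_del i.
Proof.
wlog lt_ij : i j / (index i L < index j L)%N => [IH | L_i L_j _].
  move=> L_i L_j neq_ij; case: (ltngtP (index i L) (index j L)) => lt_ij.
  - exact: IH.
  - have [//|//|//||w [w0 def_w]] := IH j i; first by rewrite eq_sym.
    exists (fun h => - w h); split=> [h /w0-> | l /def_w eq_w]; first by rewrite oppr0.
    rewrite (eq_bigr (fun h => - (A l h * w h))) => [|h _]; last by rewrite mulrN.
    by rewrite sumrN eq_w opprB.
  - by case/eqP: neq_ij; rewrite -(nth_index i L_i) lt_ij nth_index.
(* The signs become lengths of prefixes once [L] is cut at [i] and [j]. *)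
have [s1 [s2 [s3 def_L]]] : exists s1 s2 s3, L = s1 ++ i :: s2 ++ j :: s3.
  move: lt_ij L_j uniqL; case/splitPr: L_i => s1 t lt_ij L_j; rewrite cat_uniq /=.
  case/and4P => _ /norP[s1'i _] _ _; move: lt_ij L_j; rewrite index_cat (negPf s1'i) /= eqxx addn0.
  rewrite index_cat mem_cat inE; case: ifP => [s1_j | _ lt_j /= ].
    by rewrite ltnNge ltnW // index_mem.
  have [eq_ji | _] := eqVneq j i; first by rewrite eq_ji /= eqxx addn0 ltnn in lt_j.
  by case/splitPr=> s2 s3; exists s1, s2, s3.
move: uniqL; rewrite /pf_del def_L => uniq_L.
have [s1'i s1'j s2'j neq_ij] : [/\ i \notin s1, j \notin s1, j \notin s2 & i != j].
  move: uniq_L; rewrite cat_uniq => /and3P[_ /hasPn s1' /=].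
  rewrite mem_cat inE !negb_or cat_uniq => /andP[/and3P[_ neq_ij _]].
  case/and3P=> _ /hasPn s2' _; rewrite neq_ij; split=> //.
  - by apply: s1'; rewrite mem_head.
  - by apply: s1'; rewrite inE mem_cat mem_head !orbT.
  - by apply: s2'; rewrite mem_head.
have rem_cat x t t' : x \notin t -> rem x (t ++ x :: t') = t ++ t'.
  by elim: t => [|y t IHt] /=; rewrite ?eqxx // inE eq_sym => /norP[/negPf-> /IHt->].
have idx_cat x t t' : x \notin t -> index x (t ++ x :: t') = size t.
  by move=> t'x; rewrite index_cat (negPf t'x) /= eqxx addn0.
pose D := s1 ++ s2 ++ s3.
have [w [w0 def_w]] := contract_scalars (pfword A) D.
have eL : s1 ++ i :: s2 ++ j :: s3 = (s1 ++ i :: s2) ++ j :: s3 by rewrite -catA.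
have t'j : j \notin s1 ++ i :: s2.
  by rewrite mem_cat inE !negb_or s1'j eq_sym neq_ij.
set Pi := pfword A (rem i _); set Pj := pfword A (rem j _).
have P_i : pfword A (i :: D) = (-1) ^+ size s1 * Pj.
  by rewrite /Pj eL rem_cat // -catA pfword_to_front // signrMK.
have P_j : pfword A (j :: D) = (-1) ^+ size s1 * (-1) ^+ size s2 * Pi.
  by rewrite /Pi rem_cat // catA pfword_to_front // -exprD -size_cat signrMK -catA.
rewrite idx_cat // eL idx_cat // size_cat /= addnS exprS exprD.
have := sqrr_sign R (size s1); have := sqrr_sign R (size s2); rewrite !expr2.
set e2 := _ ^+ size s2 in P_j *; set e1 := _ ^+ size s1 in P_i P_j * => e22 e11.
exists (fun h => - e2 * w h); split=> [h | l L_l].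
  rewrite -eL mem_cat inE mem_cat inE !negb_or => /and5P[h1 _ h2 _ h3].
  by rewrite w0 ?mulr0 // !mem_cat !negb_or h1 h2.
rewrite (eq_bigr (fun h => - e2 * (A l h * w h))); last by move=> h _; rewrite mulrCA.
rewrite -big_distrr /= -def_w -pfword_cons.
have [-> | neq_li] := eqVneq l i.
  rewrite (negPf neq_ij) P_i /= mulr1n mulr0n; ring.
have [-> | neq_lj] := eqVneq l j.
  rewrite P_j /= mulr1n mulr0n.
  by transitivity (- (e2 * e2) * (e1 * Pi)); [ring | rewrite e22; ring].
have : l \in D.
  by move: L_l; rewrite -eL !mem_cat !inE mem_cat inE (negPf neq_li) (negPf neq_lj) /=.
by case/splitPr => t1 t2; rewrite pfword_repeat // mulr0 !mul0r subrr.
Qed.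

End Annihilation.

(** * Exactness along a regular sequence *)
Section Chase.
Variable R : idomainType.

Lemma regular_pair_vec n (a b : R) (u v : 'cV[R]_n) : regular_pair a b ->
  a *: u = b *: v -> exists w, u = b *: w.
Proof.
move=> reg eq_uv.
have /fin_all_exists[f def_f] i : exists w, u i 0 = b * w.
  by apply: (reg _ (v i 0)); have /matrixP/(_ i 0) := eq_uv; rewrite !mxE.
by exists (\col_i f i); apply/matrixP => i j; rewrite !ord1 !mxE def_f.
Qed.

Variables (n2 n1 : nat) (d2 : 'M[R]_(n1, n2)) (d3 : 'cV[R]_n2).
Hypothesis inj3 : forall y : 'cV[R]_1, d3 *m y = 0 -> y = 0.

Lemma image_by_regular_pair a b x : regular_pair b a -> a != 0 ->
    (exists u : 'cV[R]_1, a *: x = d3 *m u) -> (exists v : 'cV[R]_1, b *: x = d3 *m v) ->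
  exists y : 'cV[R]_1, x = d3 *m y.
Proof.
move=> reg nz_a [u def_u] [v def_v].
(* [b u] and [a v] have the same image [a b x] under the injective [d3]. *)
have [|w def_w] := @regular_pair_vec _ b a u v reg.
  apply/subr0_eq/inj3; rewrite mulmxBr -!scalemxAr -def_u -def_v.
  by rewrite !scalerA mulrC subrr.
by exists w; apply: (scalemx_inj nz_a); rewrite def_u def_w scalemxAr.
Qed.

Hypothesis ker2 : forall x, d2 *m x = 0 -> exists y : 'cV[R]_1, x = d3 *m y.
Hypothesis im3 : d2 *m d3 = 0.

(** The preimages [u], [v], [w] of [a x], [b x], [c x] satisfy the Koszul
    relations up to the image of [d3]; this yields a syzygy of [a], [b], [c]
    with coordinate [r1] on [c].  By regularity [r1] is in [(a, b)], so [u] and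
    [v] can be corrected by elements of the image of [d3] to satisfy
    [b u = a v] exactly, and then [u] is divisible by [a]. *)
Lemma image_by_regular_triple a b c (x : 'cV[R]_n1) :
    regular_pair b a -> regular_mod_pair a b c -> a != 0 ->
    (exists u : 'cV[R]_n2, a *: x = d2 *m u) -> (exists v : 'cV[R]_n2, b *: x = d2 *m v) ->
    (exists w : 'cV[R]_n2, c *: x = d2 *m w) ->
  exists y : 'cV[R]_n2, x = d2 *m y.
Proof.
move=> reg2 reg3 nz_a [u def_u] [v def_v] [w def_w].
have syz s t (y z : 'cV[R]_n2) : s *: x = d2 *m y -> t *: x = d2 *m z ->
    exists r : 'cV[R]_1, t *: y - s *: z = d3 *m r.
  move=> def_y def_z; apply: ker2; rewrite mulmxBr -!scalemxAr -def_y -def_z.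
  by rewrite !scalerA mulrC subrr.
have [r1 eq1] := syz _ _ _ _ def_u def_v.
have [r2 eq2] := syz _ _ _ _ def_u def_w.
have [r3 eq3] := syz _ _ _ _ def_v def_w.
have rel : c *: r1 - b *: r2 + a *: r3 = 0.
  apply: inj3; rewrite mulmxDr mulmxBr -!scalemxAr -eq1 -eq2 -eq3.
  rewrite !scalerBr !scalerA; apply/matrixP => i j; rewrite !mxE; ring.
have [|p [q def_r1]] := reg3 (r1 0 0) (- r3 0 0) (r2 0 0).
  by have /matrixP/(_ 0 0) := rel; rewrite !mxE => rel0; apply/subr0_eq; rewrite -[RHS]rel0; ring.
pose qm : 'cV[R]_1 := q%:M; pose pm : 'cV[R]_1 := p%:M.
have def_r : r1 = a *: pm + b *: qm.
  by apply/matrixP => i j; rewrite !ord1 def_r1 !mxE !mulr1n.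
have [|u' def_u'] := @regular_pair_vec _ b a (u - d3 *m qm) (v + d3 *m pm) reg2.
  rewrite scalerBr scalerDr !scalemxAr; apply/subr0_eq.
  transitivity (b *: u - a *: v - d3 *m r1); last by rewrite eq1 subrr.
  by rewrite def_r mulmxDr -!scalemxAr; apply/matrixP => i j; rewrite !mxE; ring.
exists u'; apply: (scalemx_inj nz_a); rewrite scalemxAr -def_u' mulmxBr mulmxA im3 mul0mx.
by rewrite subr0.
Qed.

End Chase.

(** * The explicit complex of an alternating matrix *)
Section OrdinalWords.
Variable m : nat.
Local Notation n := m.+1.

Definition butlast : seq 'I_n := enum [set~ ord_max].

Lemma mem_butlast i : (i \in butlast) = (i != ord_max).
Proof. by rewrite mem_enum !inE. Qed.

Lemma butlast_uniq : uniq butlast. Proof. exact: enum_uniq. Qed.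

Lemma enum_rcons_max (I : {set 'I_n}) : ord_max \in I ->
  enum I = rcons (enum (I :\ ord_max)) ord_max.
Proof.
move=> I_max; rewrite {1 2}/enum_mem -!enumT !enum_ordSr !filter_rcons /= I_max !inE eqxx /=.
congr rcons; apply: eq_in_filter => j /mapP[h _ ->] /=.
by rewrite !inE -(inj_eq val_inj) /= ltn_eqF ?ltn_ord.
Qed.

Lemma enum_ord_rcons : enum 'I_n = rcons butlast ord_max.
Proof.
rewrite (_ : enum 'I_n = enum [set: 'I_n]); last by apply: eq_enum => i; rewrite !inE.
by rewrite enum_rcons_max ?inE // /butlast; congr rcons; apply: eq_enum => i; rewrite !inE andbT.
Qed.

Lemma size_butlast : size butlast = m.
Proof. by apply/eqP; rewrite -eqSS -(size_rcons _ ord_max) -enum_ord_rcons size_enum_ord. Qed.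

Lemma index_butlast i : i != ord_max -> index i butlast = i.
Proof.
rewrite -mem_butlast => L_i; rewrite -[RHS]index_enum_ord enum_ord_rcons.
by rewrite -cats1 index_cat L_i.
Qed.

Lemma enum_rem (I : {set 'I_n}) i : enum (I :\ i) = rem i (enum I).
Proof.
rewrite rem_filter ?enum_uniq // /enum_mem -filter_predI.
by apply: eq_filter => j; rewrite /= !inE.
Qed.

Lemma rem_butlast i : rem i butlast = enum (~: [set i; ord_max]).
Proof.
by rewrite -enum_rem; apply: eq_enum => j; rewrite !inE negb_or.
Qed.

Lemma sorted_enum (I : {set 'I_n}) : sorted (fun i j : 'I_n => (i < j)%N) (enum I).
Proof.
rewrite /enum_mem sorted_filter // => [a b c|]; first exact: ltn_trans.
by rewrite -enumT; have := iota_ltn_sorted 0 n; rewrite -val_enum_ord sorted_map.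
Qed.

End OrdinalWords.

Section TopExact.
Variables (m : nat) (R : comNzRingType) (B : 'M[R]_m.+1).
Local Notation n := m.+1.

Lemma pfaffian_principal (I : {set 'I_n}) :
  pfaffian (principal_submx B I) = pfword B (enum I).
Proof.
apply: (pfaffian_word (x0 := ord0)); first by rewrite cardE.
by move=> a c; rewrite mxE !(enum_val_nth ord0).
Qed.

Lemma pfaffian_enum : pfaffian B = pfword B (enum 'I_n).
Proof.
apply: (pfaffian_word (x0 := ord0)); first by rewrite size_enum_ord.
by move=> a c; rewrite !nth_ord_enum.
Qed.

Local Notation pd := (pf_del B (butlast m)).

Lemma pf_delE i : i != ord_max -> pd i = (-1) ^+ i * pfaffian_hat B i ord_max.
Proof.
by move=> neq_i; rewrite /pf_del index_butlast // /pfaffian_hat pfaffian_principal rem_butlast.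
Qed.

Lemma top_v1E i : top_v1 B 0 i = if i == ord_max then 0 else pd i.
Proof. by rewrite mxE; case: eqVneq => // /pf_delE->. Qed.

Lemma top_v3E i : top_v3 B i 0 = if i == ord_max then pfaffian B else - pd i.
Proof. by rewrite mxE; case: eqVneq => // /pf_delE->; rewrite exprS mulN1r mulNr. Qed.

(** The last column of [top_v2 B] is a basis vector, which reduces exactness to
    the alternating matrix on the indices other than [ord_max]. *)
Lemma top_v2_mul p (X : 'M[R]_(n, p)) i k :
  (top_v2 B *m X) i k =
    \sum_(h in butlast m) B h i * X h k + (i == ord_max)%:R * X ord_max k.
Proof.
rewrite mxE (bigD1 ord_max) //= mxE eqxx addrC; congr (_ + _).
apply: eq_big => [h | h neq_h]; first by rewrite mem_butlast.
by rewrite mxE (negPf neq_h).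
Qed.

Hypotheses (altB : forall i j, B j i = - B i j) (nullB : forall i, B i i = 0).

Lemma top_v1_v2 : top_v1 B *m top_v2 B = 0.
Proof.
apply/matrixP => a h; rewrite ord1 !mxE (bigD1 ord_max) //= top_v1E eqxx mul0r add0r.
have [-> | neq_h] := eqVneq h ord_max.
  by rewrite big1 // => i neq_i; rewrite [top_v2 B _ _]mxE eqxx (negPf neq_i) mulr0.
rewrite -[RHS](pf_del_kernel altB nullB (butlast_uniq m) (l := h)) ?mem_butlast //.
apply: eq_big => [i | i neq_i]; first by rewrite mem_butlast.
by rewrite top_v1E mxE (negPf neq_i) (negPf neq_h) mulrC.
Qed.

Lemma pfaffian_last_row : odd m -> pfaffian B = \sum_(h in butlast m) B h ord_max * pd h.
Proof.
move=> odd_m; rewrite pfaffian_enum enum_ord_rcons pfword_rcons ?size_butlast //.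
rewrite pfword_cons_sum ?butlast_uniq // -sumrN.
by apply: eq_bigr => h _; rewrite altB mulNr opprK.
Qed.

Lemma top_v2_v3 : odd m -> top_v2 B *m top_v3 B = 0.
Proof.
move=> odd_m; apply/matrixP => i k; rewrite ord1 top_v2_mul [RHS]mxE.
rewrite (eq_bigr (fun h => B i h * pd h)); last first.
  move=> h; rewrite mem_butlast => neq_h.
  by rewrite top_v3E (negPf neq_h) altB mulrNN.
have [-> | neq_i] := eqVneq i ord_max; last first.
  by rewrite mul0r addr0 (pf_del_kernel altB) ?butlast_uniq ?mem_butlast.
rewrite mul1r top_v3E eqxx pfaffian_last_row // -big_split /= big1 // => h _.
by rewrite -mulrDl altB addNr mul0r.
Qed.

(** Pairing [x] with the Koszul vectors shows that [x] is proportional to the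
    subpfaffians; the last coordinate is determined by the others. *)
Lemma pf_del_ker_v2 (x : 'cV[R]_n) i : odd m -> i != ord_max -> top_v2 B *m x = 0 ->
  exists u : 'cV[R]_1, pd i *: x = top_v3 B *m u.
Proof.
move=> odd_m neq_i x0; pose u : 'cV[R]_1 := (- x i 0)%:M.
have mulu j : (top_v3 B *m u) j 0 = - (top_v3 B j 0 * x i 0).
  by rewrite mxE big_ord_recl big_ord0 !mxE addr0 mulr1n mulrN.
have eq_rel j : j != ord_max -> pd i * x j 0 = pd j * x i 0.
  move=> neq_j; have [-> // | neq_ij] := eqVneq i j.
  have [||w [w0 def_w]] := pf_del_koszul altB nullB (butlast_uniq m) _ _ neq_ij.
  - by rewrite mem_butlast.
  - by rewrite mem_butlast.
  have : \sum_(h in butlast m) w h * (top_v2 B *m x) h 0 = 0.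
    by rewrite big1 // => h _; rewrite x0 mxE mulr0.
  rewrite (eq_bigr (fun h => \sum_(l in butlast m) - (x l 0 * (B l h * - w h)))); last first.
    move=> h; rewrite mem_butlast => neq_h; rewrite top_v2_mul (negPf neq_h) mul0r addr0.
    by rewrite big_distrr; apply: eq_bigr => l _ /=; ring.
  rewrite exchange_big /= (eq_bigr (fun l => x l 0 * (\sum_h B l h * w h))); last first.
    move=> l _; rewrite big_distrr [RHS](bigID (fun h => h \in butlast m)) /=.
    rewrite [X in _ + X]big1 ?addr0 => [|h /w0->]; last by rewrite !mulr0.
    by apply: eq_bigr => h _; ring.
  rewrite (eq_bigr (fun l => (l == i)%:R * (x i 0 * pd j) - (l == j)%:R * (x j 0 * pd i))).
    rewrite sumrB (bigD1 i) ?mem_butlast //= [X in _ - X](bigD1 j) ?mem_butlast //=.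
    rewrite !eqxx !big1 => [|h /andP[_ /negPf->] | h /andP[_ /negPf->]]; rewrite ?mul0r //.
    by rewrite !mul1r !addr0 => /subr0_eq; rewrite mulrC => ->; rewrite mulrC.
  move=> l L_l; rewrite def_w //.
  have [-> | neq_li] := eqVneq l i; first by rewrite (negPf neq_ij) /= mulr1n mulr0n; ring.
  by have [-> | neq_lj] := eqVneq l j; rewrite /= ?mulr1n ?mulr0n; ring.
exists u; apply/subr0_eq; set y := _ - _.
have y0 j : j != ord_max -> y j 0 = 0.
  move=> neq_j; transitivity (pd i * x j 0 - (top_v3 B *m u) j 0); first by rewrite !mxE.
  by rewrite mulu top_v3E (negPf neq_j) mulNr opprK eq_rel // subrr.
have : (top_v2 B *m y) ord_max 0 = 0.
  by rewrite mulmxBr -scalemxAr x0 mulmxA top_v2_v3 // mul0mx scaler0 subr0 mxE.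
rewrite top_v2_mul big1 => [|h]; last by rewrite mem_butlast => /y0->; rewrite mulr0.
rewrite eqxx mul1r add0r => y_max; apply/matrixP => j k; rewrite ord1 [RHS]mxE.
by have [-> | /y0] := eqVneq j ord_max.
Qed.

(** The preimage is the combination of the Koszul vectors of the pairs [(i, j)]
    with coefficients [x j 0]; its last coordinate can be chosen freely to
    adjust the last row. *)
Lemma pf_del_ker_v1 (x : 'cV[R]_n) i : i != ord_max -> top_v1 B *m x = 0 ->
  exists u : 'cV[R]_n, pd i *: x = top_v2 B *m u.
Proof.
move=> neq_i x0.
have rel : \sum_(j in butlast m) pd j * x j 0 = 0.
  have /matrixP/(_ 0 0) := x0; rewrite [X in _ = X -> _]mxE mxE.
  rewrite (bigD1 ord_max) //= top_v1E eqxx mul0r add0r.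
  move=> eq0; rewrite -[RHS]eq0; apply: eq_big => [j | j]; first by rewrite mem_butlast.
  by rewrite mem_butlast top_v1E => /negPf->.
have /fin_all_exists[w def_w] j : exists w : 'I_n -> R, j != ord_max -> i != j ->
    (forall h, h \notin butlast m -> w h = 0) /\
    forall l, l \in butlast m ->
      \sum_h B l h * w h = (l == i)%:R * pd j - (l == j)%:R * pd i.
  have [-> | neq_j] := eqVneq j ord_max; first by exists (fun=> 0).
  have [<- | neq_ij] := eqVneq i j; first by exists (fun=> 0).
  have [||w def_w] := pf_del_koszul altB nullB (butlast_uniq m) _ _ neq_ij;
    by rewrite ?mem_butlast //; exists w.
pose u h := \sum_(j in butlast m | i != j) x j 0 * w j h.
have def_u l : l != ord_max -> \sum_(h in butlast m) B h l * u h = pd i * x l 0.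
  move=> neq_l.
  rewrite (eq_bigr (fun h =>
    \sum_(j in butlast m | i != j) - (x j 0 * (B l h * w j h)))); last first.
    by move=> h _; rewrite big_distrr; apply: eq_bigr => j _ /=; rewrite altB; ring.
  rewrite exchange_big /= (eq_bigr (fun j =>
    - x j 0 * ((l == i)%:R * pd j - (l == j)%:R * pd i))); last first.
    move=> j /andP[]; rewrite mem_butlast => neq_j neq_ij.
    have [w0 <-] := def_w j neq_j neq_ij; rewrite ?mem_butlast //.
    rewrite big_distrr [RHS](bigID (fun h => h \in butlast m)) /=.
    rewrite [X in _ + X]big1 ?addr0 => [|h /w0->]; last by rewrite !mulr0.
    by apply: eq_bigr => h _; ring.
  have [-> | neq_li] := eqVneq l i.
    move: rel; rewrite (bigD1 i) ?mem_butlast //= => /eqP; rewrite addr_eq0 => /eqP->.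
    rewrite -sumrN; apply: eq_big => [j | j /andP[_ /negPf->]]; first by rewrite eq_sym.
    by rewrite /= mulr1n mulr0n; ring.
  rewrite (bigD1 l) /=; last by rewrite mem_butlast neq_l eq_sym.
  rewrite big1 => [|j /andP[_ neq_jl]].
    by rewrite eqxx /= mulr1n mulr0n; ring.
  by rewrite eq_sym (negPf neq_jl) /= !mulr0n; ring.
have u0 : u ord_max = 0.
  rewrite /u big1 // => j /andP[]; rewrite mem_butlast => neq_j neq_ij.
  by have [w0 _] := def_w j neq_j neq_ij; rewrite w0 ?mulr0 // mem_butlast eqxx.
(* The value of the free last coordinate that makes the last row agree. *)
pose c := pd i * x ord_max 0 - \sum_(h in butlast m) B h ord_max * u h.
exists (\col_h if h == ord_max then c else u h).
apply/matrixP => l k; rewrite ord1 top_v2_mul [LHS]mxE [X in _ + _ * X]mxE eqxx.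
rewrite (eq_bigr (fun h => B h l * u h)); last first.
  by move=> h; rewrite mem_butlast mxE => /negPf->.
have [-> | neq_l] := eqVneq l ord_max; first by rewrite mul1r addrC subrK.
by rewrite mul0r addr0 def_u.
Qed.

End TopExact.

Section TopAcyclic.
Variables (m : nat) (R : idomainType) (B : 'M[R]_m.+1).
Hypotheses (altB : forall i j, B j i = - B i j) (nullB : forall i, B i i = 0).
Hypothesis odd_m : odd m.
Local Notation pd := (pf_del B (butlast m)).

Lemma acyclic_of_regular i j k :
    i != ord_max -> j != ord_max -> k != ord_max -> pd i != 0 ->
    regular_pair (pd j) (pd i) -> regular_mod_pair (pd i) (pd j) (pd k) ->
  acyclic_complex (top_v1 B) (top_v2 B) (top_v3 B).
Proof.
move=> neq_i neq_j neq_k nz_i reg2 reg3.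
have inj3 (x : 'cV[R]_1) : top_v3 B *m x = 0 -> x = 0.
  move=> /matrixP/(_ i 0); rewrite [RHS]mxE mxE big_ord1 top_v3E (negPf neq_i) => /eqP.
  rewrite mulNr oppr_eq0 mulf_eq0 (negPf nz_i) /= => /eqP x0.
  by apply/matrixP => a b; rewrite !ord1 x0 mxE.
have ker2 x : top_v2 B *m x = 0 -> exists y : 'cV[R]_1, x = top_v3 B *m y.
  by move=> x0; apply: (image_by_regular_pair inj3 reg2 nz_i); apply: pf_del_ker_v2.
split; first by split; [apply: top_v1_v2 | apply: top_v2_v3].
split=> // x x0.
by apply: (image_by_regular_triple inj3 ker2 (top_v2_v3 altB nullB odd_m) reg2 reg3 nz_i);
  apply: pf_del_ker_v1.
Qed.

End TopAcyclic.

(** * A regular sequence of pfaffians of the generic matrix *)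
Lemma regular_pure_powers (R : idomainType) k (a b c : {mpoly R[k]}) (u v w : 'I_k) D E F :
    mleadc a = 1 -> mleadc b = 1 -> mleadc c = 1 ->
    mlead a = (U_(u) *+ D)%MM -> mlead b = (U_(v) *+ E)%MM -> mlead c = (U_(w) *+ F)%MM ->
    v != u -> w != u -> w != v ->
  regular_pair b a /\ regular_mod_pair a b c.
Proof.
move=> lca lcb lcc leada leadb leadc neq_vu neq_wu neq_wv.
have cop (x y : 'I_k) M N : x != y -> mnm_coprime (U_(x) *+ M) (U_(y) *+ N).
  move=> neq_xy i; rewrite !mulmnE !mnm1E; have [eq_xi | _] := eqVneq x i; last by rewrite mul0n.
  by rewrite -eq_xi (eq_sym y) (negPf neq_xy) mul0n eqxx orbT.
split; first by apply: regular_pair_lead; rewrite // leada leadb; apply: cop; rewrite eq_sym.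
by apply: regular_mod_pair_lead; rewrite // ?leada ?leadb ?leadc; apply: cop; rewrite // eq_sym.
Qed.

Section RegularSigns.
Variable R : comNzRingType.

Lemma regular_pair_sign d e (a b : R) :
  regular_pair ((-1) ^+ d * a) ((-1) ^+ e * b) -> regular_pair a b.
Proof.
move=> reg u v eq_uv; have [|w ->] := reg u ((-1) ^+ d * ((-1) ^+ e * v)).
  transitivity ((-1) ^+ d * ((-1) ^+ e * ((-1) ^+ e * (a * u)))); first by rewrite signrMK; ring.
  by rewrite eq_uv; ring.
by exists ((-1) ^+ e * w); ring.
Qed.

Lemma regular_mod_pair_sign d e f (a b c : R) :
  regular_mod_pair ((-1) ^+ d * a) ((-1) ^+ e * b) ((-1) ^+ f * c) ->
  regular_mod_pair a b c.
Proof.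
move=> reg p u v eq_p.
have [|u' [v' ->]] := reg p ((-1) ^+ d * ((-1) ^+ f * u)) ((-1) ^+ e * ((-1) ^+ f * v)).
  transitivity ((-1) ^+ f * (c * p)); first by ring.
  rewrite eq_p mulrDr -[X in X + _](signrMK d) -[X in _ + X](signrMK e).
  by ring.
by exists ((-1) ^+ d * u'), ((-1) ^+ e * v'); ring.
Qed.

End RegularSigns.

Lemma rmorph_mpoly_id (F : comNzRingType) N (h : {rmorphism {mpoly F[N]} -> {mpoly F[N]}}) :
  (forall c, h c%:MP = c%:MP) -> (forall i, h 'X_i = 'X_i) -> h =1 id.
Proof.
move=> hC hX; elim/mpolyind => [|c k p _ _ IHp]; first exact: rmorph0.
rewrite rmorphD IHp -mul_mpolyC rmorphM hC mpolyXE_id rmorph_prod; congr (_ * _ + _).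
by apply: eq_bigr => i _; rewrite rmorphXn hX.
Qed.

Section Generic.
Variables (R0 : fieldType) (n : nat).
Local Notation R := (genR R0 n).
Local Notation S := {mpoly R[3]}.

Definition deform_var (e : 'I_#|{: ltpair n}|) : S :=
  let p := val (enum_val e) in
  ('X_e)%:MP + 'X_[U_(inZp (p.1 + p.2)) *+ n ^ (p.2 - p.1)].

Definition deform_gen : {rmorphism R -> S} :=
  mmap ((@mpolyC 3 R) \o (@mpolyC _ R0)) deform_var.

Definition undeform : {rmorphism S -> R} := meval (fun=> 0).

Lemma deform_genK : cancel deform_gen undeform.
Proof.
have varK e : undeform (deform_var e) = 'X_e.
  rewrite /deform_var /= mevalD mevalC -mpolyXn rmorphXn /= mevalXU expr0n.
  case: eqP => [/eqP | _]; last by rewrite mulr0n addr0.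
  rewrite expn_eq0; case: (n) e => [|n'] e //; case: (enum_val e) => -[[]] //.
apply: (@rmorph_mpoly_id _ _ (undeform \o deform_gen)) => [c | i].
  by rewrite /= (mmapC _ _ c) (mevalC (fun=> 0) (c%:MP)).
transitivity (undeform (deform_var i)); last exact: varK.
by congr (undeform _); apply: etrans (mmapX _ _ _) (mmap1U _ _).
Qed.

Lemma bvar_lt (i j : 'I_n) (lt_ij : (i < j)%N) :
  bvar R0 i j = 'X_(enum_rank (Sub (i, j) lt_ij : ltpair n)).
Proof. by rewrite /bvar insubT. Qed.

Lemma bvar_ge (i j : 'I_n) : (j <= i)%N -> bvar R0 i j = 0.
Proof. by move=> le_ji; rewrite /bvar insubF //= ltnNge le_ji. Qed.

Lemma deform_bvar (i j : 'I_n) : (i < j)%N ->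
  deform_gen (bvar R0 i j) = (bvar R0 i j)%:MP + 'X_[U_(inZp (i + j)) *+ n ^ (j - i)].
Proof.
move=> lt_ij; rewrite (bvar_lt lt_ij).
apply: etrans (mmapX _ _ _) _; rewrite mmap1U /deform_var.
by rewrite enum_rankK.
Qed.

Lemma genB_alt (i j : 'I_n) : genB R0 n j i = - genB R0 n i j.
Proof. by rewrite !mxE opprB. Qed.

Lemma genB_null (i : 'I_n) : genB R0 n i i = 0.
Proof. by rewrite mxE subrr. Qed.

Lemma deform_genB (i j : 'I_n) :
  deform_gen (genB R0 n i j) = deform (genB R0 n) i j.
Proof.
rewrite /deform mxE rmorphB; case: ltngtP => [lt_ij | lt_ji | eq_ij].
- by rewrite deform_bvar // (bvar_ge (ltnW lt_ij)) rmorph0 !subr0.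
- by rewrite (bvar_ge (ltnW lt_ji)) rmorph0 !sub0r deform_bvar // opprD mpolyCN addnC.
- by rewrite !bvar_ge ?eq_ij // rmorph0 !subrr mpolyC0 addr0.
Qed.

End Generic.

Section RegularPfaffians.
Variables (R0 : fieldType) (m : nat).
Hypothesis odd_m : odd m.
Local Notation R := (genR R0 m.+1).
Local Notation B := (genB R0 m.+1).
Local Notation pd := (pf_del B (butlast m)).

(** The hypothesis says that the indices other than [i] are symmetric under
    [x |-> c - x]. *)
Lemma lead_pf_del c (i : 'I_m.+1) : i != ord_max ->
    (forall x : 'I_m.+1, x != i -> x != ord_max ->
       (x <= c)%N /\ exists y : 'I_m.+1, [/\ y = (c - x)%N :> nat, y != i & y != ord_max]) ->
  exists D e : nat, mleadc ((-1) ^+ e * deform_gen R0 m.+1 (pd i)) = 1 /\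
    mlead ((-1) ^+ e * deform_gen R0 m.+1 (pd i)) = (U_(inZp c) *+ D)%MM.
Proof.
move=> neq_i sym_i; set s := rem i (butlast m).
have mem_s x : (x \in s) = (x != i) && (x != ord_max).
  by rewrite mem_rem_uniq ?butlast_uniq // inE mem_butlast.
have srt_s : sorted ltn [seq val x | x <- s].
  by rewrite sorted_map /s rem_butlast; apply: sorted_enum.
have [||||D] := @top_pfword_nested m.+1 R B c s.
- by rewrite size_rem ?mem_butlast // size_butlast; case: (m) odd_m.
- by [].
- apply: (@irr_sorted_eq _ (fun a b => (b < a)%N)).
  + by move=> a b d /= lt1 lt2; apply: ltn_trans lt2 lt1.
  + exact: ltnn.
  + by rewrite rev_sorted.
  + rewrite sorted_map; move: srt_s; rewrite sorted_map.
    apply: (@sub_in_sorted _ (mem s)); last by apply/allP.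
    move=> a b s_a s_b /= lt_ab.
    have /andP[a1 a2] : (a != i) && (a != ord_max) by rewrite -mem_s.
    have /andP[b1 b2] : (b != i) && (b != ord_max) by rewrite -mem_s.
    by have [le_a _] := sym_i a a1 a2; have [le_b _] := sym_i b b1 b2; lia.
  + move=> a; rewrite mem_rev; apply/mapP/mapP => -[x]; rewrite mem_s => /andP[x1 x2] ->;
    have [le_x [y [def_y y1 y2]]] := sym_i x x1 x2; exists y; rewrite ?mem_s ?y1 //=; lia.
- by move=> x; rewrite mem_s => /andP[x1 x2]; have [] := sym_i x x1 x2.
move=> /has_top_lead[e lead_e]; exists D, (index i (butlast m) + e)%N.
rewrite /pf_del rmorphM rmorph_sign rmorph_pfword exprD.
rewrite (eq_pfword _ (@deform_genB R0 m.+1)).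
by rewrite mulrCA -!mulrA signrMK mulrC in lead_e *.
Qed.

(** The omitted indices are 0, the middle one and the last one below [ord_max];
    the centers of symmetry [m], [m - 1], [m - 2] are distinct modulo 3. *)
Lemma regular_pf_del : (3 <= m)%N -> exists i j k : 'I_m.+1,
  [/\ i != ord_max, j != ord_max & k != ord_max] /\
  [/\ pd i != 0, regular_pair (pd j) (pd i) & regular_mod_pair (pd i) (pd j) (pd k)].
Proof.
move=> m_ge3.
have lt_m a : (a < m)%N -> (a < m.+1)%N by exact: ltnW.
have neq_max (a : 'I_m.+1) : (a != ord_max) = (val a != m) by [].
have neq_ord (a b : 'I_m.+1) : (a != b) = (val a != val b) by [].
have lt_half : (m./2 < m)%N by lia.
have lt_pred : (m.-1 < m)%N by lia.
have neq_inZp a b : (a %% 3 != b %% 3)%N -> inZp a != inZp b :> 'I_3 by [].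
have neq_10 : inZp m.-1 != inZp m :> 'I_3 by apply: neq_inZp; lia.
have neq_20 : inZp m.-2 != inZp m :> 'I_3 by apply: neq_inZp; lia.
have neq_21 : inZp m.-2 != inZp m.-1 :> 'I_3 by apply: neq_inZp; lia.
have neqs : [/\ ord0 != ord_max :> 'I_m.+1, Ordinal (lt_m _ lt_half) != ord_max
    & Ordinal (lt_m _ lt_pred) != ord_max] by rewrite !neq_max /=; split; lia.
have [||Di [ei [lci leadi]]] := @lead_pf_del m ord0.
- by rewrite neq_max /=; lia.
- move=> x; rewrite !neq_ord /= => x0 x1; split; first by have := ltn_ord x; lia.
  have lt_y : (m - x < m.+1)%N by lia.
  by exists (Ordinal lt_y); rewrite !neq_ord /=; split; have := ltn_ord x; lia.
have [||Dj [ej [lcj leadj]]] := @lead_pf_del m.-1 (Ordinal (lt_m _ lt_half)).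
- by rewrite neq_max /=; lia.
- move=> x; rewrite !neq_ord /= => x0 x1; split; first by have := ltn_ord x; lia.
  have lt_y : (m.-1 - x < m.+1)%N by lia.
  by exists (Ordinal lt_y); rewrite !neq_ord /=; split; have := ltn_ord x; lia.
have [||Dk [ek [lck leadk]]] := @lead_pf_del m.-2 (Ordinal (lt_m _ lt_pred)).
- by rewrite neq_max /=; lia.
- move=> x; rewrite !neq_ord /= => x0 x1; split; first by have := ltn_ord x; lia.
  have lt_y : (m.-2 - x < m.+1)%N by lia.
  by exists (Ordinal lt_y); rewrite !neq_ord /=; split; have := ltn_ord x; lia.
exists ord0, (Ordinal (lt_m _ lt_half)), (Ordinal (lt_m _ lt_pred)).
have nz_i := lead_neq0 lci.
have [reg2 reg3] :=
  regular_pure_powers lci lcj lck leadi leadj leadk neq_10 neq_20 neq_21.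
split; first exact: neqs.
split.
- by apply: contraNneq nz_i => ->; rewrite rmorph0 mulr0.
- exact/(regular_pair_retract (@deform_genK R0 m.+1))/(regular_pair_sign reg2).
- exact/(regular_mod_pair_retract (@deform_genK R0 m.+1))/(regular_mod_pair_sign reg3).
Qed.

End RegularPfaffians.

Lemma acyclic_top (R0 : fieldType) m : odd m -> (3 <= m)%N ->
  let B := genB R0 m.+1 in
  acyclic_complex (top_v1 B) (top_v2 B) (top_v3 B).
Proof.
move=> odd_m m_ge3 B.
have [i [j [k [[neq_i neq_j neq_k] [nz_i reg2 reg3]]]]] := @regular_pf_del R0 m odd_m m_ge3.
by apply: acyclic_of_regular reg2 reg3 => //; [apply: genB_alt | apply: genB_null].
Qed.

(** * The differentials attached to the split exact complex *)
Section SplitTop.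
Variables (m : nat) (R : idomainType) (B : 'M[R]_m.+1).
Local Notation n := m.+1.
Hypothesis altB : forall i j, B j i = - B i j.
Hypothesis nullB : forall i, B i i = 0.

Local Notation d1 := (split_d1 R m).
Local Notation d2 := (split_d2 R m).
Local Notation d3 := (split_d3 R m).
Local Notation bas := (@bas R m).
Local Notation symT := {poly {mpoly R[n]}}.

Lemma split_d2_mul (x : 'cV[R]_n) i k : (d2 *m x) i k = (i != ord_max)%:R * x i k.
Proof.
rewrite mxE (bigD1 i) //= mxE eqxx andbT big1 ?addr0 // => h neq_h.
by rewrite mxE (eq_sym i) (negPf neq_h) andbF mul0r.
Qed.

Lemma in_span_butlastP (x : 'cV[R]_n) : in_span_butlast x <-> x ord_max 0 = 0.
Proof.
split=> [[c ->] | x0].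
  by rewrite summxE big1 // => h _; rewrite !mxE (negPf (neq_lift _ _)) mulr0.
exists (fun h => x (lift ord_max h) 0); apply/matrixP => i k; rewrite ord1 summxE.
have [i' -> | ->] := unliftP ord_max i; last first.
  by rewrite x0 big1 // => h _; rewrite !mxE (negPf (neq_lift _ _)) mulr0.
rewrite (bigD1 i') //= !mxE !eqxx mulr1 big1 ?addr0 // => h neq_h.
by rewrite !mxE (inj_eq lift_inj) eq_sym (negPf neq_h) mulr0.
Qed.

(** This single formula covers [i < j], its negative and the diagonal. *)
Definition prod11 (i j : 'I_n) : 'cV[R]_n :=
  B i j *: bas ord_max + (i == ord_max)%:R *: bas j - (j == ord_max)%:R *: bas i.

Lemma prod11_lift (i j : 'I_n) (x : 'cV[R]_n) : (i < j)%N ->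
  (in_span_butlast x /\ d2 *m x = d1 0 i *: bas j - d1 0 j *: bas i) <->
  x = - ((j == ord_max)%:R *: bas i).
Proof.
move=> lt_ij; have neq_i : i != ord_max.
  by apply: contraTneq lt_ij => ->; rewrite -leqNgt -ltnS ltn_ord.
rewrite !mxE (negPf neq_i) scale0r sub0r; split=> [[/in_span_butlastP x0 eq_x] | ->].
  apply/matrixP => h k; have /matrixP/(_ h k) := eq_x; rewrite split_d2_mul ord1.
  have [-> | neq_h] := eqVneq h ord_max; last by rewrite mul1r.
  by move=> _; rewrite x0 !mxE [ord_max == i]eq_sym (negPf neq_i) /= mulr0n mulr0 oppr0.
split; first
  by apply/in_span_butlastP; rewrite !mxE [ord_max == i]eq_sym (negPf neq_i) /= mulr0n mulr0 oppr0.
apply/matrixP => h k; rewrite split_d2_mul !mxE.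
by have [-> | _] := eqVneq h ord_max; rewrite /= ?mul1r //
  [ord_max == i]eq_sym (negPf neq_i) /= mulr0n mulr0 oppr0 mulr0.
Qed.

Lemma is_prod11E ee : is_prod11 B d1 d2 ee <-> forall i j, ee i j = prod11 i j.
Proof.
have lt_prod (i j : 'I_n) : (i < j)%N ->
    prod11 i j = - ((j == ord_max)%:R *: bas i) + B i j *: bas ord_max.
  move=> lt_ij; have /negPf neq_i : i != ord_max.
    by apply: contraTneq lt_ij => ->; rewrite -leqNgt -ltnS ltn_ord.
  by rewrite /prod11 neq_i scale0r addr0 addrC.
have anti i j : prod11 j i = - prod11 i j.
  by rewrite /prod11 altB scaleNr !opprD opprK addrAC.
have null i : prod11 i i = 0 by rewrite /prod11 nullB scale0r add0r subrr.
split=> [[lt_ee [anti_ee null_ee]] i j | eq_ee].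
  case: (ltngtP i j) => [lt_ij | lt_ji | /val_inj->]; last by rewrite null_ee null.
    by have [al [/(prod11_lift _ lt_ij)-> _] ->] := lt_ee _ _ lt_ij; rewrite lt_prod.
  have [al [/(prod11_lift _ lt_ji) def_al _] eq_ji] := lt_ee _ _ lt_ji.
  by rewrite anti_ee // eq_ji def_al anti lt_prod.
split=> [i j lt_ij | ]; last by split=> [i j _ | i]; rewrite !eq_ee.
exists (- ((j == ord_max)%:R *: bas i)); last by rewrite eq_ee lt_prod.
split; first exact/(prod11_lift _ lt_ij).
by move=> x /(prod11_lift _ lt_ij).
Qed.

Lemma is_prod12E ee ef : (forall i j, ee i j = prod11 i j) ->
  is_prod12 d1 d2 d3 ee ef <-> forall i h, ef i h 0 0 = top_v2 B i h.
Proof.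
move=> eq_ee.
have lift_ef i h (x : 'cV[R]_1) :
    d3 *m x = d1 0 i *: bas h - act11 ee i (col h d2) <-> x 0 0 = top_v2 B i h.
  have -> : d1 0 i *: bas h - act11 ee i (col h d2) = top_v2 B i h *: bas ord_max.
    rewrite /act11 !mxE; have [-> | neq_h] := eqVneq h ord_max.
      by rewrite big1 ?subr0 // => j _; rewrite !mxE eqxx scale0r.
    rewrite (bigD1 h) //= big1 => [|j neq_j]; last first.
      by rewrite !mxE (negPf neq_j) andbF scale0r.
    rewrite !mxE neq_h eqxx scale1r addr0 eq_ee /prod11 (negPf neq_h) scale0r subr0.
    by rewrite opprD addrCA subrr addr0 -scaleNr -altB.
  have d3x k : (d3 *m x) k 0 = (k == ord_max)%:R * x 0 0 by rewrite mxE big_ord1 !mxE.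
  split=> [/matrixP/(_ ord_max 0) | eq_x].
    by rewrite d3x !mxE !eqxx mul1r mulr1.
  by apply/matrixP => k l; rewrite ord1 d3x eq_x [RHS]mxE [bas _ _ _]mxE eqxx andbT mulrC.
split=> [prod_ef i h | eq_ef i h]; first by apply/lift_ef; case: (prod_ef i h).
split=> [|x /lift_ef eq_x]; first exact/lift_ef.
by apply/matrixP => a b; rewrite !ord1 eq_ef eq_x.
Qed.

Local Notation Xmax := ('X_(ord_max : 'I_n) : {mpoly R[n]}).

(** Lifting is division by the variable of [f_n], which is a nonzerodivisor. *)
Lemma is_sym_liftE k l (c : {mpoly R[n]}) (z : symT) : c \is l.-homog ->
  is_sym_lift k.+1 l ((Xmax * c) *: 'X^k) z <-> z = c *: 'X^(k.+1).
Proof.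
move=> homog_c.
have injE (c' : {mpoly R[n]}) : sym_inj (c' *: 'X^(k.+1)) = (Xmax * c') *: 'X^k.
  by rewrite /sym_inj drop_polyZ exprSr (drop_polyMXn_id 1 'X^k) scalerA.
have lift_c : in_sym k.+1 l (c *: 'X^(k.+1)) /\ sym_inj (c *: 'X^(k.+1)) = (Xmax * c) *: 'X^k.
  by split; [exists c | apply: injE].
have uniq_c w : in_sym k.+1 l w /\ sym_inj w = (Xmax * c) *: 'X^k -> w = c *: 'X^(k.+1).
  case=> -[c' homog_c' ->]; rewrite injE => /(congr1 (fun p : symT => p`_k)).
  rewrite !coefZ !coefXn eqxx !mulr1 => /mulfI-> //.
  by rewrite -msize_poly_eq0 msizeX.
split=> [[/uniq_c] | ->] //; split=> // w /uniq_c //.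
Qed.

Lemma symF2_prod11 i j : symF2 (prod11 i j) =
  (B i j *: Xmax + (i == ord_max)%:R *: 'X_j - (j == ord_max)%:R *: 'X_i)%:P.
Proof.
congr (_%:P); rewrite /prod11.
have sum_bas i0 : \sum_h bas i0 h 0 *: ('X_h : {mpoly R[n]}) = 'X_i0.
  rewrite (bigD1 i0) //= !mxE !eqxx scale1r big1 ?addr0 // => h /negPf neq_h.
  by rewrite !mxE neq_h scale0r.
rewrite -!sum_bas !scaler_sumr -sumrN -!big_split /=; apply: eq_bigr => h _.
by rewrite !mxE !scalerDl scaleNr !scalerA.
Qed.

Definition word_form (w : seq 'I_n) : {mpoly R[n]} :=
  contract (fun j => 'X_j) (fun w => (pfword B w)%:MP) w.

(** The coefficient of [g ^ (t - 1)] in the t-th element attached to [I], that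
    is, a linear form in the [f_h]. *)
Definition v3_form (I : {set 'I_n}) : {mpoly R[n]} :=
  pfword B (enum I) *: Xmax -
  (if ord_max \in I then word_form (enum (I :\ ord_max)) else 0).

Lemma v3_form_homog I : v3_form I \is 1.-homog.
Proof.
have homX i : ('X_i : {mpoly R[n]}) \is 1.-homog by rewrite dhomogX /= mdeg1.
apply: rpredB; first exact: rpredZ.
case: ifP => _; last exact: rpred0.
rewrite /word_form (contract_sum _ _ _ ord0) rpred_sum // => a _.
by rewrite rpredMsign mulrC mul_mpolyC rpredZ.
Qed.

Lemma v3_form_pair (i j : 'I_n) : (i < j)%N -> symF2 (prod11 i j) = v3_form [set i; j] *: 'X^0.
Proof.
move=> lt_ij; have neq_ij : i != j by rewrite -(inj_eq val_inj) ltn_eqF.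
have neq_i : i != ord_max.
  by apply: contraTneq lt_ij => ->; rewrite -leqNgt -ltnS ltn_ord.
have enum_ij : enum [set i; j] = [:: i; j].
  apply: (irr_sorted_eq _ _ (sorted_enum _)) => [a b d|a||h]; first exact: ltn_trans.
  - exact: ltnn.
  - by rewrite /= lt_ij.
  - by rewrite mem_enum !inE.
rewrite symF2_prod11 expr0 alg_polyC (negPf neq_i) scale0r addr0; congr (_%:P).
rewrite /v3_form enum_ij !inE [ord_max == i]eq_sym (negPf neq_i) [ord_max == j]eq_sym /=.
have -> : pfword B [:: i; j] = B i j by rewrite pfword_cons /= pfword_nil mulr1 subr0.
have [-> | neq_j] := eqVneq j ord_max; last by rewrite scale0r.
have -> : [set i; ord_max] :\ ord_max = [set i].
  by apply/setP => h; rewrite !inE; case: eqVneq => //= [->|_];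
    rewrite ?orbF // eq_sym (negPf neq_i).
by rewrite enum_set1 /word_form /= mpolyC1 mulr1 subr0 scale1r.
Qed.

(** Write [enum I] as [rcons s l].  No set [J] that occurs in the recursion
    contains [ord_max], which makes its form a multiple of [Xmax].  The
    coefficients [B _ l] then build up the pfaffian of [I] expanded along [l],
    and for [l = ord_max] the other part of the products is [word_form s]. *)
Lemma v3_form_step ee v t (I : {set 'I_n}) : (forall i j, ee i j = prod11 i j) ->
    #|I| = t.+2.*2 ->
    (forall J : {set 'I_n}, #|J| = t.+1.*2 -> v t.+1 J = v3_form J *: 'X^t) ->
  v3_rhs ee v t.+2 I = (Xmax * v3_form I) *: 'X^t.
Proof.
move=> eq_ee card_I def_v; rewrite /v3_rhs doubleS [_.+2.-1]/=.
set k := t.+1.*2.+1.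
have sz_I : size (enum I) = k.+1 by rewrite -cardE card_I doubleS.
have [s [l def_I]] : exists s l, enum I = rcons s l.
  by case/lastP: (enum I) sz_I => // s l _; exists s, l.
have sz_s : size s = k by move: sz_I; rewrite def_I size_rcons => -[].
have elt_s a : (a < k)%N -> elt I a = nth ord0 s a.
  by move=> lt_a; rewrite /elt def_I nth_rcons sz_s lt_a.
have elt_l : elt I k = l by rewrite /elt def_I nth_rcons sz_s ltnn eqxx.
have /andP[s'l uniq_s] : (l \notin s) && uniq s by rewrite -rcons_uniq -def_I enum_uniq.
have s'max a : (a < k)%N -> nth ord0 s a != ord_max.
  move=> lt_a; have := sorted_enum I; rewrite def_I -(rev_sorted).
  rewrite rev_rcons /= path_sortedE => [|x y z lt1 lt2]; last exact: ltn_trans lt2 lt1.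
  case/andP => /allP/(_ (nth ord0 s a)) lt_l _.
  have := lt_l; rewrite mem_rev mem_nth ?sz_s // => /(_ isT) /= lt_al.
  by apply: contraTneq lt_al => ->; rewrite -leqNgt -ltnS ltn_ord.
have odd_s : odd (size s) by rewrite sz_s /k /= odd_double.
have max_l : (ord_max \in I) = (l == ord_max).
  rewrite -mem_enum def_I mem_rcons inE eq_sym orbC; case: (boolP (_ \in s)) => // s_max.
  have /s'max : (index ord_max s < k)%N by rewrite -sz_s index_mem.
  by rewrite nth_index // eqxx.
pose J a := I :\: [set elt I a; l].
have enum_J a : (a < k)%N -> enum (J a) = take a s ++ drop a.+1 s.
  move=> lt_a; have -> : J a = I :\ l :\ elt I a.
    by apply/setP => h; rewrite !inE negb_or -andbA.
  rewrite !enum_rem def_I; have -> : rem l (rcons s l) = s.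
    by elim: (s) s'l => [|x s0 IHs] /=; rewrite ?eqxx // inE eq_sym => /norP[/negPf-> /IHs->].
  by rewrite remE elt_s // index_uniq // sz_s.
have card_J a : (a < k)%N -> #|J a| = t.+1.*2.
  by move=> lt_a; rewrite cardE enum_J // size_cat size_take size_drop sz_s lt_a subSS subnKC.
pose Pa a : R := pfword B (take a s ++ drop a.+1 s).
have form_J a : (a < k)%N -> v3_form (J a) = Pa a *: Xmax.
  move=> lt_a; rewrite /v3_form enum_J //; case: ifP; last by rewrite subr0.
  by rewrite !inE max_l => /andP[/norP[_ neq_l]]; rewrite eq_sym (negPf neq_l).
pose term a := (B (nth ord0 s a) l * Pa a) *: Xmax -
  (l == ord_max)%:R *: ('X_(nth ord0 s a) * (Pa a)%:MP).
have -> : v3_form I = \sum_(a < k) (-1) ^+ a * term a.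
  rewrite (eq_bigr (fun a : 'I_k => ((-1) ^+ a * (B (nth ord0 s a) l * Pa a)) *: Xmax -
     (l == ord_max)%:R *: ((-1) ^+ a * ('X_(nth ord0 s a) * (Pa a)%:MP)))); last first.
    by move=> a _; rewrite /term mulrBr -!mul_mpolyC !rmorphM rmorph_sign /=; ring.
  rewrite sumrB -scaler_suml -scaler_sumr /v3_form; congr (_ *: _ - _).
    rewrite def_I pfword_rcons // pfword_cons (contract_sum _ _ _ ord0) sz_s -sumrN.
    by apply: eq_bigr => a _; rewrite altB /Pa; ring.
  rewrite max_l; have [eq_l | _] := eqVneq l ord_max; last by rewrite scale0r.
  rewrite scale1r /word_form.
  have -> : enum (I :\ ord_max) = s.
    by have := enum_rcons_max (I := I); rewrite max_l eq_l eqxx def_I eq_l => /(_ isT)/rcons_inj[].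
  by rewrite (contract_sum _ _ _ ord0) sz_s.
rewrite elt_l -[t.+2.-1]/t.+1 big_distrr scaler_suml; apply: eq_bigr => a _ /=.
have lt_a := ltn_ord a.
rewrite -/(J a) def_v ?card_J // form_J // eq_ee symF2_prod11 elt_s // (negPf (s'max _ lt_a)).
rewrite scale0r addr0 mul_polyC scalerA -!mul_polyC /term !rmorphM rmorph_sign /= .
rewrite -!mul_mpolyC !rmorphM !rmorphB !rmorphM /=; ring.
Qed.

Lemma is_v3E ee v : (forall i j, ee i j = prod11 i j) ->
  is_v3 ee v <->
  forall t (I : {set 'I_n}), #|I| = t.+1.*2 -> v t.+1 I = v3_form I *: 'X^t.
Proof.
move=> eq_ee; split=> [[v_pair v_step] | def_v].
  elim=> [|t IHt] I card_I.
    have /cards2P[i [j [neq_ij ->]]] : #|I| == 2 by rewrite card_I.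
    case: (ltngtP i j) => [lt_ij | lt_ji | /val_inj eq_ij].
    - by rewrite v_pair // eq_ee v3_form_pair.
    - by rewrite setUC v_pair // eq_ee v3_form_pair.
    - by rewrite eq_ij eqxx in neq_ij.
  have := v_step t.+2 I isT card_I; rewrite (v3_form_step eq_ee card_I) //.
  by move/(is_sym_liftE _ _ (v3_form_homog I)).
split=> [i j lt_ij | [|[|t]] I // _ card_I].
  rewrite eq_ee v3_form_pair // def_v // cards2.
  by rewrite -(inj_eq val_inj) ltn_eqF.
rewrite (v3_form_step eq_ee card_I) => [|J card_J]; last exact: def_v.
by apply/(is_sym_liftE _ _ (v3_form_homog I)); apply: def_v.
Qed.

Definition v1_form i : {mpoly R[n]} :=
  if i == ord_max then 0 else (pfaffian_hat B i ord_max)%:MP.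

Lemma card_hat (i : 'I_n) : i != ord_max -> #|~: [set i; ord_max]| = m.-1.
Proof.
move=> neq_i; have := cardsC [set i; ord_max]; by rewrite cards2 neq_i card_ord; lia.
Qed.

(** Only [j = ord_max] contributes, with sign [(-1) ^+ m.+1 = 1]. *)
Lemma qelt_form t v i : m.+1 = t.+2.*2 ->
    (forall J : {set 'I_n}, #|J| = t.+1.*2 -> v t.+1 J = v3_form J *: 'X^t) ->
  qelt d1 t.+2 v i = (Xmax * v1_form i) *: 'X^t.
Proof.
move=> def_m def_v; rewrite /qelt /=.
have d1_0 (j : 'I_n) : j != ord_max -> d1 0 j = 0 by move=> neq_j; rewrite mxE (negPf neq_j).
have odd_m : odd m by rewrite -[odd m]negbK -[~~ odd m]/(odd m.+1) def_m odd_double.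
rewrite big1 ?add0r => [|j lt_ji]; last first.
  rewrite d1_0 ?mulr0 ?mpolyC0 ?scale0r //.
  by apply: contraTneq lt_ji => ->; rewrite -leqNgt -ltnS ltn_ord.
rewrite /v1_form; have [-> | neq_i] := eqVneq i ord_max.
  rewrite mulr0 scale0r big1 // => j; rewrite ltnNge -ltnS ltn_ord //.
have lt_i : (i < (ord_max : 'I_n))%N by rewrite ltn_neqAle neq_i -ltnS ltn_ord.
rewrite (bigD1 (ord_max : 'I_n)) //= big1 ?addr0 => [|j /andP[_ neq_j]]; last first.
  by rewrite d1_0 // mulr0 mpolyC0 scale0r.
rewrite mxE eqxx mulr1 exprS -signr_odd odd_m expr1 mulrNN mulr1 mpolyC1 scale1r.
rewrite def_v ?card_hat //; last by move: def_m; rewrite doubleS => -[->].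
congr (_ *: _); rewrite /v3_form !inE eqxx orbT subr0.
by rewrite mulrC mul_mpolyC /pfaffian_hat pfaffian_principal.
Qed.

Lemma v1_form_homog i : v1_form i \is 0.-homog.
Proof.
rewrite /v1_form; case: ifP => _; first exact: rpred0.
by rewrite -[_%:MP]mulr1 mul_mpolyC rpredZ // dhomog1.
Qed.

Lemma v3_form_coef h : (v3_form [set: 'I_n])@_(U_(h)%MM) = top_v3 B h 0.
Proof.
rewrite /v3_form inE (_ : enum _ = enum 'I_n); last by apply: eq_enum => i; rewrite !inE.
rewrite -pfaffian_enum setTD -[enum (~: _)]/(butlast m).
rewrite /word_form contract_uniq ?butlast_uniq // mcoeffB mcoeffZ mcoeffX.
rewrite top_v3E raddf_sum /=.
rewrite (eq_bigr (fun j => (j == h)%:R * pf_del B (butlast m) j)) => [|j L_j]; last first.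
  rewrite (mulrC 'X_j) mul_mpolyC -(rmorph_sign (@mpolyC n R)) mul_mpolyC !mcoeffZ mcoeffX.
  by rewrite eq_mnm1 /pf_del; ring.
rewrite eq_mnm1 eq_sym; have [-> | neq_h] := eqVneq h ord_max.
  rewrite mulr1 big1 ?subr0 // => j; rewrite mem_butlast => /negPf->.
  by rewrite mul0r.
rewrite mulr0 sub0r (bigD1 h) ?mem_butlast //= eqxx mul1r big1 ?addr0 // => j /andP[_ /negPf->].
by rewrite mul0r.
Qed.

Lemma is_Ftop_split t (v1 : 'rV[R]_n) (v2 : 'M[R]_n) (v3 : 'cV[R]_n) :
    m.+1 = t.+2.*2 ->
  is_Ftop B d1 d2 d3 t.+2 v1 v2 v3 <->
  [/\ v1 = top_v1 B, v2 = top_v2 B & v3 = top_v3 B].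
Proof.
move=> def_m.
have row1 (q : 'I_n -> symT) : (forall i, q i = v1_form i *: 'X^(t.+1)) ->
    \row_i ((-1) ^+ i * ((q i)`_t.+1)@_0%MM) = top_v1 B.
  move=> def_q; apply/rowP => i; rewrite !mxE def_q coefZ coefXn eqxx mulr1 /v1_form.
  by case: ifP => _; rewrite ?mcoeff0 ?mulr0 // mcoeffC eqxx mulr1.
have mat2 (ef : 'I_n -> 'I_n -> 'cV[R]_1) : (forall i h, ef i h 0 0 = top_v2 B i h) ->
    \matrix_(i, h) ef i h 0 0 = top_v2 B.
  by move=> def_ef; apply/matrixP => i h; rewrite mxE def_ef.
have col3 (v : nat -> {set 'I_n} -> symT) : v t.+2 [set: 'I_n] = v3_form [set: 'I_n] *: 'X^(t.+1) ->
    \col_h ((v t.+2 [set: 'I_n])`_t.+1)@_(U_(h)%MM) = top_v3 B.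
  move=> def_v; apply/colP => h; rewrite mxE def_v coefZ coefXn eqxx mulr1.
  exact: v3_form_coef.
have cardT : #|[set: 'I_n]| = t.+2.*2 by rewrite cardsT card_ord.
split=> [[ee [ef [v [q [[/is_prod11E eq_ee [Hef [Hv Hq]]] [-> -> ->]]]]]] | [-> -> ->]].
  have /(is_v3E _ eq_ee) def_v := Hv; split; last exact/col3/def_v.
    apply: row1 => i; have := Hq i; rewrite (qelt_form i def_m); last exact: def_v.
    by move/(is_sym_liftE _ _ (v1_form_homog i)).
  by apply: mat2; apply/(is_prod12E _ eq_ee).
pose ef i h : 'cV[R]_1 := (top_v2 B i h)%:M.
pose v k I : symT := v3_form I *: 'X^(k.-1).
pose q i : symT := v1_form i *: 'X^(t.+1).
have def_ef i h : ef i h 0 0 = top_v2 B i h by rewrite mxE mulr1n.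
exists prod11, ef, v, q; split; last by rewrite row1 // mat2 // col3.
split; first exact/is_prod11E.
split; first exact/is_prod12E.
split; first exact/is_v3E.
move=> i; rewrite (qelt_form i def_m) //.
exact/(is_sym_liftE _ _ (v1_form_homog i)).
Qed.

End SplitTop.

Theorem theorem4p1 (R0 : fieldType) (char0 : [pchar R0] =i pred0)
    (m s : nat) (n_even : m.+1 = s.*2) (n_ge4 : (4 <= m.+1)%N) :
  let R := genR R0 m.+1 in
  let B := genB R0 m.+1 in
  (forall (v1 : 'rV[R]_m.+1) (v2 : 'M[R]_m.+1) (v3 : 'cV[R]_m.+1),
     is_Ftop B (split_d1 R m) (split_d2 R m) (split_d3 R m) s v1 v2 v3 <->
     [/\ v1 = top_v1 B, v2 = top_v2 B & v3 = top_v3 B]) /\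
  acyclic_complex (top_v1 B) (top_v2 B) (top_v3 B).
Proof.
split; last first.
  apply: acyclic_top n_ge4.
  by rewrite -[odd m]negbK -[~~ odd m]/(odd m.+1) n_even odd_double.
case: s n_even n_ge4 => [|[|t]] def_m n_ge4 v1 v2 v3.
- by [].
- by rewrite def_m in n_ge4.
exact: (is_Ftop_split (@genB_alt R0 m.+1) (@genB_null R0 m.+1) v1 v2 v3 def_m).
Qed.
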